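(* Let $n\ge2$ be an integer. For any $\gamma>0$ there exists a radial function $U$ such that the functions $$U_\lambda(x)=U(\lambda x)+n\log\lambda,\qquad\lambda>0,$$ form a $1$-parameter family of distinct (radial) solutions of $$-\Delta_n u=e^u-\gamma\delta_0\ \text{ in }\mathbb{R}^n,\qquad\int_{\mathbb{R}^n}e^u<+\infty,$$ and, for each $\lambda>0$, $U_\lambda$, as a function of $|x|\in(0,+\infty)$, takes its unique absolute maximum point at $|x|=\frac1\lambda$.
   Context: $\Delta_n u=\operatorname{div}(|\nabla u|^{n-2}\nabla u)$ is the $n$-Laplace operator and $\delta_0$ is the Dirac mass at $0$. A solution is a function $u\in C^{1,\eta}_{\mathrm{loc}}(\mathbb{R}^n\setminus\{0\})$ for some $\eta\in(0,1)$, with $\int_{\mathbb{R}^n}e^u<+\infty$, $|\nabla u|^{n-1}\in L^1_{\mathrm{loc}}(\mathbb{R}^n)$ and $\int_{\mathbb{R}^n}|\nabla u|^{n-2}\langle\nabla u,\nabla\varphi\rangle=\int_{\mathbb{R}^n}e^u\varphi-\gamma\varphi(0)$ for every compactly supported $\varphi\in C_0^1(\mathbb{R}^n)$. *)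

(* Defs.v *)
From HB Require Import structures.
From mathcomp Require Import all_boot all_order all_algebra.
From mathcomp Require Import all_classical all_reals all_analysis.

Set Implicit Arguments.
Unset Strict Implicit.
Unset Printing Implicit Defensive.

Import Order.TTheory GRing.Theory Num.Theory.
Import numFieldNormedType.Exports.

Local Open Scope classical_set_scope.
Local Open Scope ring_scope.

(* MathComp-Analysis has Lebesgue measure on the real line only, and no
   measurable structure on row vectors. As it does for tuples, we take on
   'rV[R]_n the sigma-algebra generated by the coordinate maps, i.e. the Borel
   sets, and build the n-dimensional Lebesgue measure as an iterated product. *)

Definition measure_rV_display : measure_display.
Proof. exact: default_measure_display. Qed.

Section measurable_rV.
Context {R : realType} {n : nat}.

Definition rV_coord (i : 'I_n) (x : 'rV[R]_n) : measurableTypeR R := x 0 i.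

Let rV_set0 : g_sigma_preimage rV_coord set0.
Proof. exact: sigma_algebra0. Qed.

Let rV_setC A : g_sigma_preimage rV_coord A -> g_sigma_preimage rV_coord (~` A).
Proof. exact: sigma_algebraC. Qed.

Let rV_bigcup (F : _^nat) : (forall i, g_sigma_preimage rV_coord (F i)) ->
  g_sigma_preimage rV_coord (\bigcup_i (F i)).
Proof. exact: sigma_algebra_bigcup. Qed.

HB.instance Definition _ := @isMeasurable.Build measure_rV_display
  'rV[R]_n (g_sigma_preimage rV_coord) rV_set0 rV_setC rV_bigcup.

End measurable_rV.

Lemma measurable_rV_coord (R : realType) n (i : 'I_n) :
  measurable_fun [set: 'rV[R]_n] (rV_coord i).
Proof.
move=> _ Y mY; rewrite setTI; apply: sub_sigma_algebra => /=.
rewrite -bigcup_seq/=; exists i => /=; first by rewrite mem_index_enum.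
by exists Y => //; rewrite setTI.
Qed.

Lemma measurable_fun_rVP d (T : measurableType d) (R : realType) n
    (f : T -> 'rV[R]_n) :
  measurable_fun [set: T] f <->
  forall i, measurable_fun [set: T] (rV_coord i \o f).
Proof.
split=> [mf i|mf].
  by apply: measurableT_comp => //; exact: measurable_rV_coord.
have prefS : g_sigma_preimage (fun i => rV_coord i \o f) `<=` measurable.
  apply: smallest_sub; first exact: sigma_algebra_measurable.
  case: n => [|n] in f mf *; first by rewrite big_ord0.
  rewrite -bigcup_mkord_ord; apply: bigcup_sub => i Ii.
  by move=> A [B mB <-]; exact: mf.
rewrite g_sigma_preimage_comp in prefS.
by move=> _ A mA; apply: prefS; exists A.
Qed.

Section lebesgue_rV.
Context {R : realType}.

Definition rV_cons n (p : measurableTypeR R * 'rV[R]_n) : 'rV[R]_n.+1 :=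
  \row_i (if unlift ord0 i is Some j then p.2 0 j else p.1).

Definition rV_uncons n (x : 'rV[R]_n.+1) : measurableTypeR R * 'rV[R]_n :=
  (x 0 ord0, \row_j x 0 (lift ord0 j)).

Lemma rV_consK n : cancel (@rV_cons n) (@rV_uncons n).
Proof.
move=> [a x]; rewrite /rV_uncons /rV_cons !mxE unlift_none; congr pair.
by apply/rowP => j; rewrite !mxE liftK.
Qed.

Lemma measurable_rV_cons n : measurable_fun [set: _] (@rV_cons n).
Proof.
apply/measurable_fun_rVP => i.
rewrite (_ : _ \o _ = fun p : measurableTypeR R * 'rV[R]_n =>
  if unlift ord0 i is Some j then rV_coord j p.2 else p.1).
  case: (unlift ord0 i) => [j|]; last exact: measurable_fst.
  apply: (measurableT_comp (@measurable_rV_coord R n j)).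
  exact: measurable_snd.
by apply/funext => p; rewrite /rV_coord /= mxE.
Qed.

Lemma measurable_rV_uncons n : measurable_fun [set: _] (@rV_uncons n).
Proof.
apply: measurable_fun_pair; first exact: (@measurable_rV_coord R n.+1 ord0).
apply/measurable_fun_rVP => j.
rewrite (_ : _ \o _ = rV_coord (lift ord0 j)); first exact: measurable_rV_coord.
by apply/funext => x; rewrite /rV_coord /= mxE.
Qed.

Section lebesgue_rV_succ.
Variables (n : nat) (mu : {sigma_finite_measure set 'rV[R]_n -> \bar R}).

Definition lebesgue_rV_succ : set 'rV[R]_n.+1 -> \bar R :=
  pushforward (lebesgue_measure \x mu)%E (@rV_cons n).

Let pushforward_cons : {measure set 'rV[R]_n.+1 -> \bar R} :=
  measure_function_pushforward__canonical__measure_function_Measure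
    (lebesgue_measure \x mu)%E (measurable_rV_cons (n := n)).

Let lebesgue_rV_succ0 : lebesgue_rV_succ set0 = 0%E.
Proof. exact: (measure0 pushforward_cons). Qed.

Let lebesgue_rV_succ_ge0 A : (0 <= lebesgue_rV_succ A)%E.
Proof. exact: (measure_ge0 pushforward_cons). Qed.

Let lebesgue_rV_succ_sigma_additive : semi_sigma_additive lebesgue_rV_succ.
Proof. exact: (@measure_semi_sigma_additive _ _ _ pushforward_cons). Qed.

HB.instance Definition _ := isMeasure.Build _ _ _ lebesgue_rV_succ
  lebesgue_rV_succ0 lebesgue_rV_succ_ge0 lebesgue_rV_succ_sigma_additive.

Let lebesgue_rV_succ_sigma_finite : sigma_finite setT lebesgue_rV_succ.
Proof.
have /sigma_finiteP[F [FT ndF Foo]] := sigma_finiteT (@lebesgue_measure R).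
have /sigma_finiteP[G [GT ndG Goo]] := sigma_finiteT mu.
exists (fun k => @rV_uncons n @^-1` (F k `*` G k)).
  rewrite -preimage_bigcup; apply/esym/seteqP; split => // x _ /=.
  have [i _ Fi] : (\bigcup_i F i) (rV_uncons x).1 by rewrite -FT.
  have [j _ Gj] : (\bigcup_i G i) (rV_uncons x).2 by rewrite -GT.
  exists (maxn i j) => //; split.
    by move: Fi; exact/subsetPset/ndF/leq_maxl.
  by move: Gj; exact/subsetPset/ndG/leq_maxr.
move=> k; have [mF Fk] := Foo k; have [mG Gk] := Goo k; split.
  rewrite -[X in measurable X]setTI; apply: measurable_rV_uncons => //.
  exact: measurableX.
rewrite /lebesgue_rV_succ /pushforward -comp_preimage.
rewrite (_ : _ \o _ = id) ?preimage_id; last first.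
  by apply/funext => p /=; rewrite rV_consK.
by rewrite product_measure1E// lte_mul_pinfty// ge0_fin_numE.
Qed.

HB.instance Definition _ := Measure_isSigmaFinite.Build _ _ _ lebesgue_rV_succ
  lebesgue_rV_succ_sigma_finite.

End lebesgue_rV_succ.

Fixpoint lebesgue_rV (n : nat) : {sigma_finite_measure set 'rV[R]_n -> \bar R} :=
  if n is n'.+1 then lebesgue_rV_succ (lebesgue_rV n') else \d_(0 : 'rV[R]_0).

Lemma lebesgue_rV_box n (A : 'I_n -> set (measurableTypeR R)) :
  (forall i, measurable (A i)) ->
  lebesgue_rV n [set x | forall i, A i (x 0 i)] =
  (\prod_(i < n) lebesgue_measure (A i))%E.
Proof.
elim: n A => [|n IHn] A mA.
  rewrite big_ord0 /= diracE mem_set//.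
  by move=> [].
rewrite big_ord_recl -(IHn (fun j => A (lift ord0 j)))//=.
rewrite -product_measure1E//=; last first.
  rewrite (_ : (fun x => _) =
    \bigcap_(j in [set: 'I_n]) rV_coord j @^-1` (A (lift ord0 j))).
    apply: fin_bigcap_measurable => // j _.
    by rewrite -[X in measurable X]setTI; exact: measurable_rV_coord.
  by apply/seteqP; split => x /= xA j; [move=> _; exact: xA|exact: xA].
rewrite /lebesgue_rV_succ /pushforward; congr product_measure1.
apply/seteqP; split => -[a x] /=.
  move=> xA; split; first by have := xA ord0; rewrite mxE unlift_none.
  by move=> j; have := xA (lift ord0 j); rewrite mxE liftK.
move=> [aA xA] i; rewrite mxE; case: unliftP => [j ->|->] //.
Qed.

End lebesgue_rV.
Arguments lebesgue_rV R n : clear implicits.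

Section euclidean.
Context {R : realType} {n : nat}.
Implicit Types x y : 'rV[R]_n.

Definition dotrV x y : R := \sum_(i < n) x 0 i * y 0 i.

(* The Euclidean norm: the norm `|x| of the library on 'rV[R]_n is the
   sup-norm, which induces the same topology but is not rotation-invariant. *)
Definition enorm x : R := Num.sqrt (dotrV x x).

Definition gradient (u : 'rV[R]_n -> R) x : 'rV[R]_n :=
  \row_i 'D_(delta_mx 0 i) u x.

End euclidean.

Section n_liouville.
Context {R : realType} {n : nat}.
Implicit Types (u U phi : 'rV[R]_n -> R) (V : R -> R).

(* Functions on R^n \ {0} are represented by total functions whose value at
   the origin is irrelevant. *)
Definition C1holder_loc_punctured (eta : R) u : Prop :=
  (forall x, x != 0 -> differentiable u x) /\
  (forall K : set 'rV[R]_n, compact K -> ~ K 0 ->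
     exists C : R, forall x y, K x -> K y ->
       enorm (gradient u x - gradient u y) <= C * enorm (x - y) `^ eta).

Definition C1_compact_support phi : Prop :=
  [/\ forall x, differentiable phi x,
      continuous (gradient phi) &
      compact (closure [set x | phi x != 0])].

(* u is a solution of -Delta_n u = e^u - gamma delta_0 in R^n with
   int_(R^n) e^u < +oo. The integrals are over the whole of R^n since {0} is
   negligible. *)
Definition is_solution (gamma : R) u : Prop :=
  [/\ exists2 eta : R, 0 < eta < 1 & C1holder_loc_punctured eta u,
      (\int[lebesgue_rV R n]_x (expR (u x))%:E < +oo)%E,
      forall K : set 'rV[R]_n, compact K ->
        (lebesgue_rV R n).-integrable K
          (fun x => (enorm (gradient u x) ^+ n.-1)%:E) &
      forall phi, C1_compact_support phi ->
        (\int[lebesgue_rV R n]_x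
           (enorm (gradient u x) ^+ (n - 2)
              * dotrV (gradient u x) (gradient phi x))%:E =
         \int[lebesgue_rV R n]_x (expR (u x) * phi x)%:E
           - (gamma * phi 0)%:E)%E].

Definition has_profile u V : Prop :=
  forall x, x != 0 -> u x = V (enorm x).

Definition radial u : Prop := exists V, has_profile u V.

Definition rescaled U (lambda : R) : 'rV[R]_n -> R :=
  fun x => U (lambda *: x) + n%:R * ln lambda.

Definition unique_max_at V (r0 : R) : Prop :=
  0 < r0 /\ forall r, 0 < r -> r != r0 -> V r < V r0.

End n_liouville.

(* Main.v *)
Require Import Defs.
From mathcomp Require Import all_boot all_order all_algebra.
From mathcomp Require Import all_classical all_reals all_analysis.
From mathcomp Require Import measurable_realfun.
From mathcomp Require Import ring lra.

(* In the variable t = log |x| the radial equation for u = v(log |x|) is the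
   autonomous system v' = |w|^(1/(n-1)) sgn w, w' = - e^(v + n t), where w is the
   flux |grad u|^(n-2) du/dr r^(n-1). The quantity e^(v + n t) is a concave
   function H(w), so w' = - H(w) is solved by separation of variables: w
   decreases from a root w0 > 0 of H to its negative root, and v increases while
   w > 0 and decreases while w < 0. Dilations of U are translations in t.
   No polar coordinates are used: since x / |x|^n is divergence free off 0, the
   divergence theorem (Fubini and the one-dimensional fundamental theorem) shows
   that the integral of K'(log |x|) |x|^-n dx vanishes for compactly supported K
   and hence that the integral of k(log |x| - s) |x|^-n dx, for a bump k of
   integral 1, does not depend on s. This constant replaces the area of the
   sphere: it fixes w0 in terms of gamma, and testing the equation against phi
   cut off near 0 gives the Dirac mass in the limit. *)

Import Order.TTheory GRing.Theory Num.Theory.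
Import numFieldNormedType.Exports.

Local Open Scope classical_set_scope.
Local Open Scope ring_scope.

(** * Calculus on the real line *)

(** The flux field |grad u|^(n-2) grad u equals w(log |x|) x / |x|^n. As [w] tends to w0 > 0 at
    [-oo], u behaves like w0^(1/(n-1)) log |x| at the origin, and the limit [w0] is all that the
    point mass sees of the solution. The orbit is therefore parametrised by [w0]; the freedom left,
    translation in t, is spent on [w 0 = 0]. The flux of U then changes sign on the unit sphere,
    where the maximum lies, and dilation by lambda moves it to radius 1/lambda. The position of a
    strict maximum also tells the members of the family apart.

    Integrability near 0 and near infinity comes from a single principle: if f is bounded and
    nondecreasing, then f'(log |x|) |x|^-n is integrable. For f = - w this is the finiteness of the
    integral of e^u. For f the logistic function it yields an integrable weight comparable to
    |x|^(1-n) near 0, which dominates the flux and justifies the passage to the limit in the cutoff.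

    The gradient is in general only Holder continuous: z |-> |z|^(n-2) z has an inverse of exponent
    1/(n-1) at 0, the value that the flux takes on the sphere of the maximum. *)

Section derive_rules.
Context {R : realType} {V : normedModType R}.
Implicit Types (f g : V -> R) (x v : V).

Lemma is_derive_funD f g x v df dg : is_derive x v f df -> is_derive x v g dg ->
  is_derive x v (fun y => f y + g y) (df + dg).
Proof. exact: is_deriveD. Qed.

Lemma is_derive_funB f g x v df dg : is_derive x v f df -> is_derive x v g dg ->
  is_derive x v (fun y => f y - g y) (df - dg).
Proof. exact: is_deriveB. Qed.

Lemma is_derive_funN f x v df : is_derive x v f df ->
  is_derive x v (fun y => - f y) (- df).
Proof. exact: is_deriveN. Qed.

Lemma is_derive_funM f g x v df dg : is_derive x v f df -> is_derive x v g dg ->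
  is_derive x v (fun y => f y * g y) (df * g x + f x * dg).
Proof. by move=> Df Dg; rewrite addrC (mulrC df); exact: is_deriveM. Qed.

Lemma derive_line f x v : 'D_v f x = 'D_1 (fun t : R => f (t *: v + x)) 0.
Proof.
rewrite /derive; set g1 := fun h => h^-1 *: _; set g2 := fun h => h^-1 *: _.
suff -> : g1 = g2 by [].
by apply/funext => t; rewrite /g1 /g2 /= addr0 scale0r add0r [_ *: 1]mulr1.
Qed.

(** Only the derivative of [f] along [v] is assumed; restriction to the line [t *: v + x] reduces
    the claim to the chain rule in one variable. *)
Lemma is_derive_fun_comp f (h : R -> R) x v df dh :
  is_derive x v f df -> is_derive (f x) 1 h dh ->
  is_derive x v (fun y => h (f y)) (dh * df).
Proof.
move=> [/derivable1P Df fE] Dh.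
have Df' : is_derive (0 : R) 1 (fun t : R => f (t *: v + x)) df.
  apply: (@DeriveDef _ _ _ _ _ _ _ Df); by rewrite -fE derive_line.
have Dh' : is_derive (f ((0 : R) *: v + x)) 1 h dh by rewrite scale0r add0r.
have [H1 H2] := is_derive1_comp Dh' Df'.
apply: DeriveDef; first exact/derivable1P.
by rewrite derive_line; exact: H2.
Qed.

End derive_rules.

Section continuous_rules.
Context {R : realType} {T : topologicalType}.
Implicit Types (f g : T -> R) (x : T).

Lemma continuous_funD f g x : continuous_at x f -> continuous_at x g ->
  continuous_at x (fun y => f y + g y).
Proof. exact: continuousD. Qed.

Lemma continuous_funB f g x : continuous_at x f -> continuous_at x g ->
  continuous_at x (fun y => f y - g y).
Proof. exact: continuousB. Qed.

Lemma continuous_funM f g x : continuous_at x f -> continuous_at x g ->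
  continuous_at x (fun y => f y * g y).
Proof. exact: continuousM. Qed.

Lemma continuous_fun_comp f (h : R -> R) x :
  continuous_at x f -> continuous_at (f x) h ->
  continuous_at x (fun y => h (f y)).
Proof. exact: (@continuous_comp _ _ _ f h). Qed.

Lemma continuous_sum_ord n (F : 'I_n -> T -> R) x :
  (forall i, continuous_at x (F i)) ->
  continuous_at x (fun y => \sum_(i < n) F i y).
Proof.
move=> cF; elim: n F cF => [|n IHn] F cF.
  by rewrite (_ : (fun _ => _) = cst 0); [exact: cst_continuous|
     apply/funext => y; rewrite big_ord0].
rewrite (_ : (fun _ => _) =
    fun y => F ord0 y + \sum_(i < n) F (lift ord0 i) y); last first.
  by apply/funext => y; rewrite big_ord_recl.
by apply: continuous_funD => //; exact: IHn.
Qed.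

End continuous_rules.

Section calculus.
Context {R : realType}.
Implicit Types (f g df : R -> R).

Lemma derive1_continuous f df : (forall x : R, is_derive x 1 f (df x)) -> continuous f.
Proof.
by move=> fdf x; apply/differentiable_continuous/derivable1_diffP; case: (fdf x).
Qed.

Lemma MVT_global f df a b : (forall x : R, is_derive x 1 f (df x)) -> a <= b ->
  exists2 c, a <= c <= b & f b - f a = df c * (b - a).
Proof.
move=> fdf ab.
have fdf' (x : R) : x \in `]a, b[ -> is_derive x 1 f (df x) by move=> _; exact: fdf.
have cf : {within `[a, b], continuous f}.
  exact/continuous_subspaceT/(derive1_continuous _ _ fdf).
have [c + E] := MVT_segment ab fdf' cf.
by rewrite in_itv /= => cab; exists c.
Qed.

Lemma MVT_global_lt f df a b :
  (forall x : R, is_derive x 1 f (df x)) -> a < b ->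
  exists2 c, a < c < b & f b - f a = df c * (b - a).
Proof.
move=> fdf ab.
have fdf' (x : R) : x \in `]a, b[ -> is_derive x 1 f (df x) by move=> _; exact: fdf.
have cf : {within `[a, b], continuous f}.
  exact/continuous_subspaceT/(derive1_continuous _ _ fdf).
have [c + E] := MVT ab fdf' cf.
by rewrite in_itv /= => cab; exists c.
Qed.

Lemma antiderivative_exists g : continuous g ->
  exists2 G : R -> R, G 0 = 0 & forall x : R, is_derive x 1 G (g x).
Proof.
move=> cg; set mu := @lebesgue_measure R.
have intg a b : mu.-integrable `[a, b] (EFin \o g).
  apply: continuous_compact_integrable; first exact: segment_compact.
  exact: continuous_subspaceT.
pose F a x := (\int[mu]_(t in `[a, x]) g t)%R.
have Fge a x : x <= a -> F a x = 0.
  rewrite le_eqVlt => /predU1P[->|xa].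
    by rewrite /F set_itv1 Rintegral_set1.
  by rewrite /F set_itv_ge ?Rintegral_set0// bnd_simp -ltNge.
have FB a x y : a <= x -> x <= y -> F a y - F a x = F x y.
  move=> ax xy; rewrite /F Rintegral_itvB//.
  by rewrite Rintegral_itv_obnd_cbnd//; apply: integrableS (intg x y) => //;
     exact: subset_itv_oc_cc.
(* [F a x] vanishes for [x <= a], so one of the two terms is zero and the difference is the oriented
   integral from 0 to x. Near a given point it coincides with [F N y - F N 0], where [N] lies to the
   left of that point and of 0, and the fundamental theorem with fixed left endpoint applies. *)
exists (fun x => F 0 x - F x 0) => [|x]; first by rewrite subrr.
pose N := - (`|x| + 1); pose u := `|x| + 1.
have Nx : N < x.
  by rewrite /N ltrNl (le_lt_trans (ler_norm _))// normrN ltrDl.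
have xu : x < u by rewrite (le_lt_trans (ler_norm _))// ltrDl.
have N0 : N <= 0 by rewrite oppr_le0 addr_ge0.
have [dF F'] := @continuous_FTC1_closed R g N x u xu (intg N u) Nx (cg x).
have DF : is_derive x 1 (fun y => F N y - F N 0) (g x).
  have : is_derive x 1 (F N) (g x) by apply: DeriveDef; rewrite -?derive1E.
  move=> D; have D0 := is_derive_cst (F N 0) x 1.
  by have := is_derive_funB _ _ _ _ _ _ D D0; rewrite subr0.
apply: near_eq_is_derive DF; near=> y.
have Ny : N <= y by near: y; apply: (cvgr_ge x) => //; exact: cvg_id.
have [y0|y0] := leP 0 y; first by rewrite FB// (Fge y 0)// subr0.
by rewrite (Fge 0 y) ?(ltW y0)// sub0r -(FB N y 0) ?(ltW y0)// opprB.
Unshelve. all: by end_near. Qed.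

(** The bound [c] forces at least linear growth in both directions, hence injectivity and, by the
    intermediate value theorem, surjectivity. *)
Lemma derive_pos_bij f df c : 0 < c -> (forall x, c <= df x) ->
  (forall x : R, is_derive x 1 f (df x)) ->
  exists2 g : R -> R, cancel f g /\ cancel g f &
    forall y : R, is_derive y 1 g (df (g y))^-1.
Proof.
move=> c0 cdf fdf; have cf := derive1_continuous _ _ fdf.
have incf a b : a <= b -> c * (b - a) <= f b - f a.
  move=> ab; have [x _ ->] := MVT_global _ _ _ _ fdf ab.
  by rewrite ler_wpM2r// subr_ge0.
have finj : injective f.
  move=> a b; wlog ab : a b / a <= b => [H E|E].
    by case: (leP a b) => [|/ltW] /H; [exact|move=> ->].
  have := incf _ _ ab; rewrite E subrr pmulr_rle0// subr_le0 => ba.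
  by apply/eqP; rewrite eq_le ab.
have fsurj y : exists x, f x = y.
  (* Chosen so that linear growth at rate [c] from [f 0] gives [f (- M) <= y <= f M]. *)
  pose M := (`|y| + `|f 0|) / c.
  have M0 : 0 <= M by rewrite divr_ge0 ?addr_ge0 ?(ltW c0).
  have cM : c * M = `|y| + `|f 0| by rewrite /M mulrCA divff ?mulr1 ?gt_eqF.
  have fM : y <= f M.
    have := incf 0 M M0; rewrite subr0 cM lerBrDr; apply: le_trans.
    by rewrite -addrA ler_wpDr ?ler_norm// -lerBlDr sub0r lerNl lerNnormlW.
  have fNM : f (- M) <= y.
    have := incf (- M) 0; rewrite oppr_le0 sub0r opprK cM => /(_ M0).
    rewrite lerBrDr -lerBrDl => /le_trans; apply.
    rewrite opprD addrC -addrA; have := ler_norm (f 0); have := ler_norm (- y).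
    by rewrite normrN; lra.
  have NMM : - M <= M by lra.
  have cfM : {within `[- M, M], continuous f} by exact: continuous_subspaceT.
  have [|x _ fx] := @IVT R f (- M) M y NMM cfM; last by exists x.
  by rewrite minEle maxEle (le_trans fNM fM) fNM.
pose g y := xget 0 [set x | f x = y].
have gK : cancel g f.
  move=> y; rewrite /g; case: xgetP => [x _ //|].
  by have [x fx] := fsurj y => /(_ x) /(_ fx).
have fK : cancel f g by move=> x; apply: finj; rewrite gK.
exists g => // y; rewrite -{1}(gK y).
apply: (@is_derive_inverse R f g).
- by near=> z; exact: fK.
- by near=> z; exact: cf.
- by rewrite gt_eqF// (lt_le_trans c0).
Unshelve. all: by end_near. Qed.

End calculus.

(** * The radial differential equation *)

Section autonomous_ode.
Context {R : realType}.

(** It serves twice: to parametrise a bounded interval by the line, and later as a bounded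
    increasing function whose derivative is comparable to e^t at [-oo]. *)
Definition logistic (s : R) : R := (1 + expR (- s))^-1.

Lemma logistic_gt0 s : 0 < logistic s.
Proof. by rewrite invr_gt0 addr_gt0 ?expR_gt0. Qed.

Lemma logistic_lt1 s : logistic s < 1.
Proof. by rewrite invf_lt1 ?addr_gt0 ?expR_gt0// ltrDl expR_gt0. Qed.

Lemma logistic_le_expR s : logistic s <= expR s.
Proof.
by rewrite -[leRHS]invrK -expRN lef_pV2 ?posrE ?addr_gt0 ?expR_gt0// ler_wpDl.
Qed.

Lemma logistic_onem s : 1 - logistic s = expR (- s) * logistic s.
Proof.
have := expR_gt0 (- s) => e0; rewrite /logistic; field; rewrite gt_eqF//; lra.
Qed.

Lemma is_derive_logistic (s : R) :
  is_derive s 1 logistic (logistic s * (1 - logistic s)).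
Proof.
have N0 : 1 + expR (- s) != 0 by rewrite gt_eqF// addr_gt0 ?expR_gt0.
have D : is_derive s 1 (fun s : R => 1 + expR (- s)) (- expR (- s)).
  by apply: is_derive_eq; ring.
have := is_deriveV (f := fun s : R => 1 + expR (- s)) N0 D.
rewrite logistic_onem => H; apply: is_derive_eq H _.
by rewrite /logistic /GRing.scale /=; field.
Qed.

Lemma continuous_segment_bound (f : R -> R) a b : a <= b -> continuous f ->
  exists2 C, 0 < C & forall x, a <= x <= b -> `|f x| <= C.
Proof.
move=> ab cf.
have cnf : {within `[a, b], continuous (fun x => `|f x|)}.
  apply: continuous_subspaceT => x.
  by apply: (@continuous_comp _ _ _ f Num.norm (x : R)); [exact: cf|exact: norm_continuous].
have [c _ fc] := EVT_max ab cnf.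
exists (`|f c| + 1) => [|x xab]; first by rewrite ltr_pwDr.
by rewrite (le_trans (fc x _)) ?lerDl.
Qed.

(* The substitution w = b - (b - a) logistic s turns dt = - dw / H(w) into
   dt = G(s) ds with G continuous and bounded below by a positive constant on the
   whole line, so that s |-> t is a bijection of the line. *)
Lemma autonomous_ode (H dH : R -> R) a b c :
  (forall x : R, is_derive x 1 H (dH x)) -> continuous dH ->
  H a = 0 -> H b = 0 -> (forall x, a < x < b -> 0 < H x) -> a < c < b ->
  exists w : R -> R, [/\ w 0 = c, forall t, a < w t < b,
    forall t : R, is_derive t 1 w (- H (w t)) & w t @[t --> -oo] --> b].
Proof.
move=> HdH cdH Ha Hb H0 /andP[ac cb].
have ab : a < b by rewrite (lt_trans ac).
have ab0 : 0 < b - a by rewrite subr_gt0.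
have [C C0 dHC] := continuous_segment_bound dH a b (ltW ab) cdH.
pose om s := b - (b - a) * logistic s.
have om_itv s : a < om s < b.
  have := logistic_gt0 s; have := logistic_lt1 s; rewrite /om => l1 l0.
  by apply/andP; split; nra.
(* [H] vanishes at both ends and has slope at most [C], so it is below C (b - x) and below C (x -
   a). Weighting these bounds by x - a and b - x gives a product that vanishes at both ends, exactly
   as the derivative of [om] does. *)
have HB x : a < x < b -> (b - a) * H x <= 2 * C * ((b - x) * (x - a)).
  move=> /andP[ax xb].
  have [d1 /andP[d1x d1b] E1] := MVT_global H dH _ _ HdH (ltW xb).
  have [d2 /andP[d2x d2b] E2] := MVT_global H dH _ _ HdH (ltW ax).
  have := dHC d1; rewrite d1b (le_trans (ltW ax) d1x) => /(_ isT).
  have := dHC d2; rewrite d2x (le_trans d2b (ltW xb)) => /(_ isT).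
  rewrite !ler_norml => /andP[_ C2] /andP[C1 _].
  have H1 : H x <= C * (b - x) by rewrite Hb in E1; nra.
  have H2 : H x <= C * (x - a) by rewrite Ha in E2; nra.
  have -> : (b - a) * H x = H x * (x - a) + H x * (b - x) by ring.
  by nra.
pose G s := (b - a) * (logistic s * (1 - logistic s)) / H (om s).
have Dom (s : R) : is_derive s 1 om (- ((b - a) * (logistic s * (1 - logistic s)))).
  have D := is_derive_logistic s.
  by rewrite /om; apply: is_derive_eq; rewrite /GRing.scale /=; ring.
have Hom s : 0 < H (om s) by apply: H0.
have cG : continuous G.
  move=> s; have cl := derive1_continuous _ _ is_derive_logistic s.
  apply: continuous_funM; last first.
    apply: continuousV; first by rewrite gt_eqF.
    apply: continuous_fun_comp; first exact: (derive1_continuous _ _ Dom).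
    exact: (derive1_continuous _ _ HdH).
  apply: continuous_funM; first exact: cst_continuous.
  by apply: continuous_funM => //; apply: continuous_funB => //; exact: cst_continuous.
have G_ge s : (2 * C)^-1 <= G s.
  rewrite /G ler_pdivlMr// ler_pdivrMl ?mulr_gt0// -(ler_pM2l ab0).
  apply: le_trans (HB _ (om_itv s)) _; rewrite /om le_eqVlt; apply/orP; left.
  by apply/eqP; ring.
have [T T0 DT] := antiderivative_exists G cG.
have C20 : 0 < (2 * C)^-1 by rewrite invr_gt0 mulr_gt0.
have [S [TK SK] DS] := derive_pos_bij T G _ C20 G_ge DT.
have T_le x y : x <= y -> T x <= T y.
  move=> xy; have [d _ E] := MVT_global T G _ _ DT xy.
  by rewrite -subr_ge0 E mulr_ge0 ?subr_ge0// (le_trans (ltW C20)).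
pose p := (b - c) / (b - a).
have p0 : 0 < p by rewrite divr_gt0 ?subr_gt0.
have p1 : p < 1 by rewrite ltr_pdivrMr// mul1r ltrD2l ltrN2.
have ip0 : 0 < p^-1 - 1 by rewrite subr_gt0 invf_gt1.
(* The solution of [logistic s0 = p], hence of [om s0 = c]; a time shift by [T s0] then makes the
   solution start at [c]. *)
pose s0 := - ln (p^-1 - 1).
have om_s0 : om s0 = c.
  rewrite /om /logistic /s0 opprK lnK ?posrE// addrCA subrr addr0 invrK /p.
  by rewrite mulrCA divff ?gt_eqF// mulr1 subKr.
exists (fun t => om (S (t + T s0))); split.
- by rewrite add0r TK.
- by move=> t; exact: om_itv.
- move=> t.
  have DSt : is_derive t 1 (fun t => S (t + T s0)) (G (S (t + T s0)))^-1.
    have Dt : is_derive t 1 (fun t => t + T s0) 1.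
      by apply: is_derive_eq; rewrite addr0.
    by have := is_derive_fun_comp _ S _ _ _ _ Dt (DS _); rewrite mulr1.
  apply: (is_derive_eq (is_derive_fun_comp _ om _ _ _ _ DSt (Dom _))).
  have l0 := logistic_gt0 (S (t + T s0)); have l1 := logistic_lt1 (S (t + T s0)).
  rewrite /G; field; rewrite !gt_eqF//; first by rewrite subr_gt0.
- apply/cvgrPdist_lt => e e0.
  (* Since b - om s <= (b - a) e^s, the distance to [b] is below [e] once s < s1, which is a
     condition on t because [T] is monotone. *)
  pose s1 := ln (e / (b - a)); exists (T s1 - T s0); split; first exact: num_real.
  move=> t ts1; rewrite /om opprB addrC subrK.
  rewrite gtr0_norm ?mulr_gt0 ?logistic_gt0// -ltr_pdivlMl// mulrC.
  rewrite -[ltRHS]lnK ?posrE ?divr_gt0//.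
  apply: le_lt_trans (logistic_le_expR _) _; rewrite ltr_expR -/s1 ltNge.
  apply/negP => /T_le; rewrite SK; lra.
Qed.

End autonomous_ode.

(** * The signed root and its Holder continuity *)

Section signed_root.
Context {R : realType} (k : nat).
Implicit Types a b : R.

(** The inverse of z |-> |z|^k z. With n = k + 2 it recovers v' from the flux |v'|^(n-2) v'. *)
Definition sroot a : R := Num.sg a * `|a| `^ k.+1%:R^-1.

Lemma powR_invnK a : 0 <= a -> (a `^ k.+1%:R^-1) ^+ k.+1 = a.
Proof.
move=> a0; rewrite -powR_mulrn ?powR_ge0// -powRrM mulVf ?powRr1//.
Qed.

Lemma norm_sroot a : `|sroot a| = `|a| `^ k.+1%:R^-1.
Proof.
rewrite /sroot normrM (ger0_norm (powR_ge0 _ _)) normr_sg.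
by case: eqP => [->|_]; rewrite ?mul1r// normr0 powR0 ?mul0r// invr_eq0.
Qed.

Lemma norm_srootX a : `|sroot a| ^+ k.+1 = `|a|.
Proof. by rewrite norm_sroot powR_invnK. Qed.

Lemma sroot_normX a : `|sroot a| ^+ k * sroot a = a.
Proof.
rewrite {2}/sroot -norm_sroot mulrCA -exprSr norm_srootX.
by rewrite -numEsg.
Qed.

Lemma sroot0 : sroot 0 = 0. Proof. by rewrite /sroot sgr0 mul0r. Qed.

Lemma sroot_gt0 a : 0 < a -> 0 < sroot a.
Proof. by move=> a0; rewrite /sroot gtr0_sg// mul1r powR_gt0// normr_gt0 gt_eqF. Qed.

Lemma srootN a : sroot (- a) = - sroot a.
Proof. by rewrite /sroot sgrN normrN mulNr. Qed.

Lemma sroot_pexp c : 0 < c -> sroot (c ^+ k.+1) = c.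
Proof.
move=> c0; rewrite /sroot gtr0_sg ?exprn_gt0// mul1r ger0_norm ?exprn_ge0 ?ltW//.
by rewrite -powR_mulrn ?ltW// -powRrM divff ?powRr1 ?ltW.
Qed.

(** Raised to the power [k.+1], this becomes y^(k+1) + z^(k+1) <= (y + z)^(k+1) for nonnegative y
    and z, by induction on [k]. *)
Lemma powR_invn_subadd a b : 0 <= a -> 0 <= b ->
  (a + b) `^ k.+1%:R^-1 <= a `^ k.+1%:R^-1 + b `^ k.+1%:R^-1.
Proof.
move=> a0 b0; rewrite -(@ler_pXn2r _ k.+1) ?nnegrE ?addr_ge0 ?powR_ge0//.
rewrite powR_invnK ?addr_ge0// -{1}(powR_invnK a a0) -{1}(powR_invnK b b0).
move: (powR_ge0 a k.+1%:R^-1) (powR_ge0 b k.+1%:R^-1).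
move: (a `^ _) (b `^ _) => y z y0 z0 {a a0 b b0}.
elim: k => [|m IH]; first by rewrite !expr1.
rewrite exprS (exprS z) (exprS (y + z)).
have h1 := exprn_ge0 m.+1 y0; have h2 := exprn_ge0 m.+1 z0.
apply: le_trans (ler_wpM2l (addr_ge0 y0 z0) IH); nra.
Qed.

(** For arguments of the same sign, subadditivity of the root gives the constant 1. For opposite
    signs both |a| and |b| are at most |a - b|, whence the factor 2. *)
Lemma sroot_holder a b : `|sroot a - sroot b| <= 2 * `|a - b| `^ k.+1%:R^-1.
Proof.
set p := k.+1%:R^-1; have p0 : 0 <= p by rewrite invr_ge0.
wlog ab : a b / b <= a => [H|].
  have [/H//|/ltW/H] := leP b a.
  by rewrite distrC (distrC b).
have mono x y : 0 <= x -> x <= y -> x `^ p <= y `^ p.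
  by move=> x0 xy; apply: ge0_ler_powR => //; rewrite nnegrE// (le_trans x0).
have nneg x : 0 <= x -> sroot x = x `^ p.
  rewrite le_eqVlt => /predU1P[<-|x0].
    by rewrite sroot0 powR0// invr_eq0.
  by rewrite /sroot gtr0_sg// mul1r gtr0_norm.
have pos x y : 0 <= y -> y <= x -> `|sroot x - sroot y| <= 2 * `|x - y| `^ p.
  move=> y0 yx; have x0 := le_trans y0 yx.
  rewrite !nneg// ger0_norm ?subr_ge0 ?mono//.
  rewrite (ger0_norm (_ : 0 <= x - y)) ?subr_ge0//.
  have := powR_invn_subadd (x - y) y; rewrite subr_ge0 => /(_ yx y0).
  rewrite subrK -/p; have := powR_ge0 (x - y) p; lra.
have [b0|b0] := leP 0 b; first exact: pos.
have [a0|a0] := leP a 0.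
  have := pos (- b) (- a); rewrite oppr_ge0 lerN2 => /(_ a0 ab).
  by rewrite !srootN !opprK addrC (addrC _ a).
rewrite (ger0_norm (_ : 0 <= a - b)) ?subr_ge0//.
have -> : sroot b = - sroot (- b) by rewrite srootN opprK.
rewrite opprK !nneg ?oppr_ge0 ?(ltW a0) ?(ltW b0)//.
rewrite ger0_norm ?addr_ge0 ?powR_ge0//.
have h1 : a `^ p <= (a - b) `^ p by apply: mono; lra.
have h2 : (- b) `^ p <= (a - b) `^ p by apply: mono; lra.
lra.
Qed.

Lemma sroot_lt a b : a < b -> sroot a < sroot b.
Proof.
have pos x y : 0 <= y -> y < x -> sroot y < sroot x.
  move=> y0 yx; have x0 := le_lt_trans y0 yx.
  rewrite /sroot (gtr0_sg x0) (gtr0_norm x0) mul1r.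
  move: y0; rewrite le_eqVlt => /predU1P[<-|y0].
    by rewrite sgr0 mul0r powR_gt0.
  rewrite gtr0_sg// mul1r gtr0_norm//.
  by apply: gt0_ltr_powR; rewrite ?nnegrE ?invr_gt0 ?ltW.
move=> ab; have [a0|a0] := leP 0 a; first exact: pos.
have [b0|b0] := ltP 0 b.
  rewrite (lt_trans _ (sroot_gt0 _ b0))// -oppr_gt0 -srootN.
  by apply: sroot_gt0; rewrite oppr_gt0.
by rewrite -ltrN2 -!srootN; apply: pos; rewrite ?oppr_ge0 ?ltrN2.
Qed.

Lemma sroot_le a b : a <= b -> sroot a <= sroot b.
Proof. by rewrite le_eqVlt => /predU1P[->//|/sroot_lt/ltW]. Qed.

Lemma sroot_continuous : continuous sroot.
Proof.
move=> a; apply/cvgrPdist_lt => e e0.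
have d0 : 0 < (e / 2) ^+ k.+1 by rewrite exprn_gt0// divr_gt0.
exists ((e / 2) ^+ k.+1) => //= b ab.
apply: le_lt_trans (sroot_holder _ _) _; rewrite -ltr_pdivlMl// mulrC.
rewrite -(@ltr_pXn2r _ k.+1) ?nnegrE ?powR_ge0 ?divr_ge0 ?(ltW e0)//.
by rewrite powR_invnK.
Qed.

End signed_root.

Section profile.
Context {R : realType}.

(* With z = v + d t, the radial equation is the planar system z' = d + sroot w,
   w' = - e^z; it conserves e^z + d w + (primitive of sroot)(w), so it reduces
   to w' = - H w with H the concave function below, and e^z = H w. *)
Lemma radial_profile (k : nat) (d w0 : R) : 0 < d -> 0 < w0 ->
  exists v w : R -> R,
   [/\ forall t : R, is_derive t 1 w (- expR (v t + d * t)),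
       forall t : R, is_derive t 1 v (sroot k (w t)),
       exists M, forall t, `|w t| <= M,
       w t @[t --> -oo] --> w0 & w 0 = 0].
Proof.
move=> d0 w00.
have [P P0 DP] := antiderivative_exists _ (@sroot_continuous R k).
pose H x := d * (w0 - x) + (P w0 - P x); pose dH x := - d - sroot k x.
have DH (x : R) : is_derive x 1 H (dH x).
  by rewrite /H; apply: is_derive_eq; rewrite /dH /GRing.scale /=; ring.
have cdH : continuous dH.
  move=> x; apply: continuous_funB; first exact: cst_continuous.
  exact: sroot_continuous.
have Hw0 : H w0 = 0 by rewrite /H !subrr mulr0 addr0.
(* The critical point of [H]: [dH x = 0] means [sroot k x = - d]. *)
pose ws := - (d ^+ k.+1).
have sws : sroot k ws = - d by rewrite /ws srootN sroot_pexp.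
(* To the left of [A] the slope [dH] is at least 1, so [H] drops by at least [|H A|] between [A] and
   the point [B] below, where it is therefore nonpositive. The negative root is found between [B]
   and [ws]. *)
pose A := - ((d + 1) ^+ k.+1).
have sA : sroot k A = - (d + 1) by rewrite /A srootN sroot_pexp// addr_gt0.
have Aws : A < ws.
  by rewrite /A /ws ltrN2 ltr_pXn2r ?nnegrE ?addr_ge0 ?(ltW d0)// ltrDl.
have ws0 : ws < 0 by rewrite /ws oppr_lt0 exprn_gt0.
have Hws : 0 < H ws.
  have [c /andP[wsc _] E] := MVT_global_lt H dH _ _ DH (lt_trans ws0 w00).
  have := sroot_lt k _ _ wsc; rewrite sws => sc.
  by move: E; rewrite Hw0 sub0r /dH => E; nra.
pose B := A - `|H A|.
have HB : H B <= 0.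
  have BA : B <= A by rewrite gerBl.
  have [c /andP[_ cA] E] := MVT_global H dH _ _ DH BA.
  have := sroot_le k _ _ cA; rewrite sA => sc.
  have := ler_norm (H A); have := normr_ge0 (H A).
  move: E; rewrite /dH {2}/B; nra.
have Bws : B <= ws by rewrite /B (le_trans _ (ltW Aws))// gerBl.
have cH := derive1_continuous _ _ DH.
have [|a /[!in_itv]/= /andP[Ba aws] Ha] :=
    @IVT R H B ws 0 Bws (continuous_subspaceT cH).
  by rewrite minEle maxEle (le_trans HB (ltW Hws)) HB (ltW Hws).
have {}aws : a < ws.
  by rewrite lt_neqAle aws andbT; apply: contraTneq Hws => <-; rewrite Ha ltxx.
(* [H] increases from its root [a] up to [ws], then decreases to its root [w0]. *)
have Hpos x : a < x < w0 -> 0 < H x.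
  move=> /andP[ax xw0]; have [xws|wsx] := leP x ws.
    have [c /andP[_ cx] E] := MVT_global_lt H dH _ _ DH ax.
    have := sroot_lt k _ _ (lt_le_trans cx xws); rewrite sws => sc.
    by move: E; rewrite Ha subr0 /dH => ->; nra.
  have [c /andP[xc _] E] := MVT_global_lt H dH _ _ DH xw0.
  have := sroot_lt k _ _ (lt_trans wsx xc); rewrite sws => sc.
  by move: E; rewrite Hw0 sub0r /dH => E; nra.
have a0 : a < 0 < w0 by rewrite w00 (lt_trans aws ws0).
have [w [w_0 wab Dw wNy]] := autonomous_ode H dH a w0 0 DH cdH Ha Hw0 Hpos a0.
(* The conservation law e^(v + d t) = H(w) is taken as the definition of [v]; with w' = - H(w) it
   gives v' = - dH(w) - d, which is the signed root of w. *)
pose v t := ln (H (w t)) - d * t.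
have vE t : expR (v t + d * t) = H (w t) by rewrite /v subrK lnK// posrE Hpos.
exists v, w; split => //.
- by move=> t; rewrite vE.
- move=> t; have Hwt := Hpos _ (wab t).
  have D1 := is_derive_fun_comp _ H _ _ _ _ (Dw t) (DH (w t)).
  have D2 := is_derive_fun_comp _ (@ln R) _ _ _ _ D1 (is_derive1_ln Hwt).
  rewrite /v; apply: is_derive_eq; rewrite /dH /GRing.scale /=; field.
  by rewrite gt_eqF.
- exists (w0 - a) => t; rewrite ler_norml.
  by move: (wab t) a0 => /andP[? ?] /andP[? ?]; apply/andP; split; lra.
Qed.

End profile.

(** * Lebesgue measure on row vectors *)

Section borel_rV.
Context {R : realType} {n : nat}.
Implicit Types (A : set 'rV[R]_n) (f : 'rV[R]_n -> R).

Lemma measurable_rV_box (B : 'I_n -> set (measurableTypeR R)) : (forall i, measurable (B i)) ->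
  measurable [set x : 'rV[R]_n | forall i, B i (x 0 i)].
Proof.
move=> mB; rewrite (_ : [set _ | _] =
    \bigcap_(j in [set: 'I_n]) rV_coord j @^-1` (B j)).
  apply: fin_bigcap_measurable => // j _.
  by rewrite -[X in measurable X]setTI; exact: measurable_rV_coord.
by apply/seteqP; split => x /= xA j; [move=> _; exact: xA|exact: xA].
Qed.

(** The sigma-algebra is generated by the coordinates, so an open set has to be written as a
    countable union of boxes; those with rational centre and radius 1/(m+1) contained in the set
    suffice. *)
Lemma open_measurable_rV A : open A -> measurable A.
Proof.
move=> oA.
pose box (p : n.-tuple rat * nat) : set 'rV[R]_n :=
  [set x | forall i, ball (ratr (tnth p.1 i) : R) (p.2.+1%:R^-1) (x 0 i)].
pose F m := if unpickle m is Some p then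
  (if `[< box p `<=` A >] then box p else set0) else set0.
suff -> : A = \bigcup_m F m.
  apply: bigcupT_measurable => m; rewrite /F; case: (unpickle m) => // p.
  case: asboolP => // _.
  apply: (measurable_rV_box (fun i => ball (ratr (tnth p.1 i) : R) p.2.+1%:R^-1)).
  by move=> i; exact: measurable_ball.
apply/seteqP; split => [x Ax|x [m _]]; last first.
  by rewrite /F; case: unpickle => // p; case: asboolP => // pA /pA.
have /nbhs_ballP[e /= e0 xeA] := open_nbhs_nbhs (conj oA Ax).
(* Half of [e], because a point of the box is reached from [x] through the centre, at the cost of
   two radii. *)
have [k _ ke] : exists2 k : nat, True & k.+1%:R^-1 < e / 2 :> R.
  have e2 : 0 < e / 2 by rewrite divr_gt0.
  have [k _ /(_ _ (leqnn k)) ke] := near_infty_natSinv_lt (PosNum e2).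
  by exists k.
have k0 : 0 < k.+1%:R^-1 :> R by rewrite invr_gt0.
have /choice[q qx] : forall i, exists q : rat, `|ratr q - x 0 i| < k.+1%:R^-1.
  move=> i; have : x 0 i - k.+1%:R^-1 < x 0 i + k.+1%:R^-1.
    by rewrite ltrD2l (lt_trans _ k0)// oppr_lt0.
  move=> /rat_in_itvoo[q]; rewrite in_itv /= => /andP[q1 q2]; exists q.
  by rewrite ltr_distl q1 q2.
pose p : n.-tuple rat * nat := (mktuple q, k).
have pE i : tnth p.1 i = q i by rewrite tnth_mktuple.
exists (pickle p) => //; rewrite /F pickleK.
have px : box p x by move=> i; rewrite pE /ball /=; exact: qx.
case: asboolP => // -[] y py; apply: xeA; split => // i j; rewrite (ord1 i).
have := px j; have := py j; rewrite /= pE /ball /= => yj xj.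
have -> : x 0 j - y 0 j = (x 0 j - ratr (q j)) + (ratr (q j) - y 0 j) by ring.
apply: le_lt_trans (ler_normD _ _) _; rewrite (distrC (x 0 j)).
by rewrite (lt_trans (ltrD xj yj))// [ltRHS]splitr ltrD.
Qed.

Lemma open_continuous_measurable_rV A f : open A ->
  (forall x, A x -> continuous_at x f) -> measurable_fun A f.
Proof.
move=> oA cf; apply: (measurability _ (RGenOpens.measurableE R)).
move=> _ [_ [a [b ->] <-]]; apply: open_measurable_rV.
rewrite openE => x [Ax fx]; apply: filterI; first exact: open_nbhs_nbhs.
by apply: (cf x Ax); apply: open_nbhs_nbhs; split => //; exact: interval_open.
Qed.

Lemma continuous_measurable_rV f : continuous f -> measurable_fun setT f.
Proof.
by move=> cf; apply: open_continuous_measurable_rV => //; exact: openT.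
Qed.

Lemma compact_bounded_rV A : compact A -> exists2 B : R, 0 < B & A `<=` [set x | `|x| <= B].
Proof.
move=> /compact_bounded[M [_ MA]]; exists (`|M| + 1); first by rewrite ltr_wpDl.
by move=> x Ax /=; apply: MA => //; rewrite ltr_pwDr// ler_norm.
Qed.

Lemma compact_measurable_rV A : compact A -> measurable A.
Proof.
move=> cA; rewrite -[A]setCK; apply: measurableC; apply: open_measurable_rV.
by apply: closed_openC; apply: compact_closed cA; exact: norm_hausdorff.
Qed.

Lemma coord_le_norm_rV (x : 'rV[R]_n) i : `|x 0 i| <= `|x|.
Proof.
have -> : `|x| = mx_norm x by [].
by rewrite mx_normrE; exact: (le_bigmax _ (fun i : 'I_1 * 'I_n => `|x i.1 i.2|) (0, i)).
Qed.

Lemma norm_le_rV (x : 'rV[R]_n) B : 0 <= B -> (forall i, `|x 0 i| <= B) -> `|x| <= B.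
Proof.
move=> B0 xB; have -> : `|x| = mx_norm x by [].
by rewrite mx_normrE; apply: bigmax_le => // -[i j] _ /=; rewrite (ord1 i).
Qed.

(** The closed ball of the sup-norm, in the form of a box whose measure and compactness are known
    coordinatewise. *)
Definition cube (B : R) : set 'rV[R]_n :=
  [set x | forall i, `[- B, B]%classic (x 0 i)].

Lemma cubeP B x : 0 <= B -> cube B x <-> `|x| <= B.
Proof.
move=> B0; split => [Bx|xB i].
  by apply: norm_le_rV => // i; have := Bx i; rewrite /= in_itv /= -ler_norml.
by rewrite /= in_itv /= -ler_norml (le_trans (coord_le_norm_rV x i)).
Qed.

Lemma measurable_cube B : measurable (cube B).
Proof.
by apply: (measurable_rV_box (fun=> `[- B, B]%classic)) => i; exact: measurable_itv.
Qed.

Lemma lebesgue_rV_cube B : 0 < B -> (lebesgue_rV R n (cube B) < +oo)%E.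
Proof.
move=> B0; rewrite (@lebesgue_rV_box R n (fun=> `[- B, B]%classic)); last first.
  by move=> i; exact: measurable_itv.
under eq_bigr do rewrite lebesgue_measure_itv /= lte_fin gt0_cp// -EFinB.
by rewrite prodEFin ltry.
Qed.

Lemma continuous_bounded_support_bounded f B : continuous f ->
  (forall x, B < `|x| -> f x = 0) -> exists2 C, 0 <= C & forall x, `|f x| <= C.
Proof.
(* [B] is an arbitrary real, possibly negative; [M] is positive and larger. *)
move=> cf fB; pose M := `|B| + 1; have M0 : 0 < M by rewrite ltr_wpDl.
have BM : B < M by rewrite ltr_pwDr// ler_norm.
have : compact (f @` cube M).
  apply: continuous_compact; first exact: continuous_subspaceT.
  apply: (@rV_compact R n (fun=> `[- M, M]%classic)) => i; exact: segment_compact.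
move=> /compact_bounded[K [_ fK]]; exists (`|K| + 1); first by rewrite addr_ge0.
move=> x; have [xM|Mx] := leP `|x| M.
  apply: fK; first by rewrite ltr_pwDr// ler_norm.
  by exists x => //; apply/cubeP => //; exact: ltW.
by rewrite fB ?normr0 ?addr_ge0// (lt_trans BM).
Qed.

Lemma continuous_bounded_support_integrable f B : continuous f ->
  (forall x, B < `|x| -> f x = 0) -> (lebesgue_rV R n).-integrable setT (EFin \o f).
Proof.
move=> cf fB; pose M := `|B| + 1; have M0 : 0 < M by rewrite ltr_wpDl.
have BM : B < M by rewrite ltr_pwDr// ler_norm.
have fM : f = f \_ (cube M).
  apply/funext => x; rewrite patchE; case: ifPn => // /negP xM.
  apply: fB; rewrite ltNge; apply/negP => xB; apply: xM; rewrite inE.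
  by apply/cubeP; [exact: ltW|rewrite (le_trans xB)// ltW].
rewrite fM -restrict_EFin; apply/integrable_restrict => //.
  exact: measurable_cube.
rewrite setTI.
apply: measurable_bounded_integrable => //.
- exact: measurable_cube.
- exact: lebesgue_rV_cube.
- apply: measurable_funTS; exact: continuous_measurable_rV.
have [C _ fC] := continuous_bounded_support_bounded f B cf fB.
exists C; split; first exact: num_real.
by move=> y Cy x _ /=; rewrite (le_trans (fC x))// ltW.
Qed.

End borel_rV.

(** * The divergence theorem *)

Section divergence.
Context {R : realType}.

(** Only the line through [a] along [v] matters, and [g] maps it affinely to a line of direction
    [w]. Both the slices of R^(n+1) and the coordinate maps are of this kind. *)
Lemma is_derive_affine (V W : normedModType R) (g : V -> W) (f : W -> R) a v w df :
  (forall h : R, g (h *: v + a) = h *: w + g a) ->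
  is_derive (g a) w f df -> is_derive a v (fun x => f (g x)) df.
Proof.
move=> ga [Df <-].
have E : (fun h => h^-1 *: (f (g (h *: v + a)) - f (g a))) =
         (fun h => h^-1 *: (f (h *: w + g a) - f (g a))).
  by apply/funext => h; rewrite ga.
by apply: DeriveDef; rewrite /derivable /derive /= E.
Qed.

Lemma integral_derive1_bounded_support (f df : R -> R) B : continuous df ->
  (forall x : R, is_derive x 1 f (df x)) ->
  (forall x, B < `|x| -> f x = 0) -> (forall x, B < `|x| -> df x = 0) ->
  (\int[lebesgue_measure]_x (df x)%:E = 0)%E.
Proof.
move=> cdf Df fB dfB; pose M := `|B| + 1.
have M0 : 0 < M by rewrite ltr_wpDl.
have BM : B < M by rewrite ltr_pwDr// ler_norm.
have -> : (fun x => (df x)%:E) = (EFin \o df) \_ `[- M, M].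
  apply/funext => x; rewrite patchE; case: ifPn => //= /negP xM.
  rewrite dfB// ltNge; apply/negP => xB; apply: xM; rewrite inE /= in_itv /=.
  by rewrite -ler_norml (le_trans xB)// ltW.
rewrite -integral_mkcond.
have NMM : - M < M by rewrite gtrN.
have cf := derive1_continuous _ _ Df.
rewrite (@continuous_FTC2 R df f) ?fB ?subee//.
- by rewrite normrN gtr0_norm.
- by rewrite gtr0_norm.
- exact: continuous_subspaceT.
- split => [x _| |]; first by case: (Df x).
  + exact: cvg_at_right_filter (cf _).
  + exact: cvg_at_left_filter (cf _).
- by move=> x _; rewrite derive1E derive_val.
Qed.

Lemma rV_cons_shift0 n (h a : R) (y : 'rV[R]_n) :
  rV_cons (h *: 1 + a, y) = h *: delta_mx 0 ord0 + rV_cons (a, y).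
Proof.
apply/rowP => i; rewrite !mxE /= [h *: 1]mulr1.
case: unliftP => [j ->|->]; first by rewrite mulr0 add0r.
by rewrite mulr1.
Qed.

Lemma rV_cons_shiftS n (h a : R) (j : 'I_n) (y : 'rV[R]_n) :
  rV_cons (a, h *: delta_mx 0 j + y) = h *: delta_mx 0 (lift ord0 j) + rV_cons (a, y).
Proof.
apply/rowP => i; rewrite !mxE /=.
case: unliftP => [k ->|->]; last by rewrite mulr0 add0r.
by rewrite !mxE (inj_eq (@lift_inj _ _)).
Qed.

Lemma norm_rV_consB n (a b : R) (y z : 'rV[R]_n) :
  `|rV_cons (a, y) - rV_cons (b, z)| <= Num.max `|a - b| `|y - z|.
Proof.
apply: norm_le_rV => [|i]; first by rewrite le_max normr_ge0.
rewrite !mxE /= le_max; case: unliftP => [j _|_]; last by rewrite lexx.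
by have := coord_le_norm_rV (y - z) j; rewrite !mxE => ->; rewrite orbT.
Qed.

Lemma rV_cons_continuous2 n (a : R) : continuous (fun y : 'rV[R]_n => rV_cons (a, y)).
Proof.
move=> y; apply/(@cvgrPdist_lt _ _ _ _ (nbhs_filter y)) => e e0.
have := nbhsx_ballx y e e0; rewrite -ball_normE; apply: filterS => z /= yz.
apply: le_lt_trans (norm_rV_consB _ _ _ _ _) _.
by rewrite subrr normr0 gt_max e0 /=.
Qed.

Lemma rV_cons_continuous1 n (y : 'rV[R]_n) : continuous (fun a : R => rV_cons (a, y)).
Proof.
move=> a; apply/(@cvgrPdist_lt _ _ _ _ (nbhs_filter a)) => e e0.
have := nbhsx_ballx a e e0; rewrite -ball_normE; apply: filterS => b /= ab.
apply: le_lt_trans (norm_rV_consB _ _ _ _ _) _.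
by rewrite subrr normr0 gt_max e0 andbT.
Qed.

Lemma norm_rV_cons1 n (a : R) (y : 'rV[R]_n) : `|a| <= `|rV_cons (a, y)|.
Proof.
by have := coord_le_norm_rV (rV_cons (a, y)) ord0; rewrite mxE unlift_none.
Qed.

Lemma norm_rV_cons2 n (a : R) (y : 'rV[R]_n) : `|y| <= `|rV_cons (a, y)|.
Proof.
apply: norm_le_rV => // i.
by have := coord_le_norm_rV (rV_cons (a, y)) (lift ord0 i); rewrite mxE liftK.
Qed.

(** The measure in dimension [n.+1] is an image of the product measure; the first conjunct is the
    integrability that Fubini requires. *)
Lemma integral_lebesgue_rVS n (f : 'rV[R]_n.+1 -> R) B : continuous f ->
  (forall x, B < `|x| -> f x = 0) ->
  (lebesgue_measure \x lebesgue_rV R n)%E.-integrable setT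
     (EFin \o (fun p => f (rV_cons p))) /\
  (\int[lebesgue_rV R n.+1]_x (f x)%:E =
   \int[lebesgue_measure \x lebesgue_rV R n]_p (f (rV_cons p))%:E)%E.
Proof.
move=> cf fB.
have mf := continuous_measurable_rV f cf.
have mcons := @measurable_rV_cons R n.
have intf : (lebesgue_measure \x lebesgue_rV R n)%E.-integrable setT
     (EFin \o (fun p => f (rV_cons p))).
  apply/integrableP; split.
    by apply/measurable_EFinP; exact: (measurableT_comp mf mcons).
  have /integrableP[_] := continuous_bounded_support_integrable f B cf fB.
  rewrite [X in (X < _)%E -> _](_ : _ =
    \int[pushforward (lebesgue_measure \x lebesgue_rV R n) (@rV_cons R n)]_x `|(EFin \o f) x|)%E //.
  rewrite ge0_integral_pushforward//.
  by apply: measurableT_comp => //; exact/measurable_EFinP.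
split => //.
rewrite [LHS](_ : _ =
    \int[pushforward (lebesgue_measure \x lebesgue_rV R n) (@rV_cons R n)]_x (EFin \o f) x)%E //.
rewrite integral_pushforward//; exact/measurable_EFinP.
Qed.

(** Induction on the dimension. Fubini is applied in the order that integrates first the block
    containing coordinate [i]: the tail, by the induction hypothesis, or the leading coordinate, by
    the fundamental theorem. *)
Lemma integral_partial_derive_aux n (i : 'I_n) (G dG : 'rV[R]_n -> R) B :
  continuous dG ->
  (forall x : 'rV[R]_n, is_derive x (delta_mx 0 i) G (dG x)) ->
  (forall x, B < `|x| -> G x = 0) -> (forall x, B < `|x| -> dG x = 0) ->
  (\int[lebesgue_rV R n]_x (dG x)%:E = 0)%E.
Proof.
elim: n i G dG => [[]//|n IHn] i G dG cdG DG GB dGB.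
have [intf ->] := integral_lebesgue_rVS n dG B cdG dGB.
have := unliftP ord0 i; case=> [j ij|i0].
  rewrite -(integral12_prod_meas1 intf); apply: integral0_eq => a _ /=.
  apply: (IHn j (fun y => G (rV_cons (a, y)))).
  - by move=> y; apply: continuous_comp; [exact: rV_cons_continuous2|exact: cdG].
  - move=> y; apply: (@is_derive_affine 'rV[R]_n 'rV[R]_n.+1 (fun y => rV_cons (a, y)) G y
      (delta_mx 0 j) (delta_mx 0 (lift ord0 j))).
      move=> h; exact: rV_cons_shiftS.
    by rewrite -ij.
  - by move=> y yB; apply: GB; rewrite (lt_le_trans yB)// norm_rV_cons2.
  - by move=> y yB; apply: dGB; rewrite (lt_le_trans yB)// norm_rV_cons2.
rewrite -(integral21_prod_meas1 intf); apply: integral0_eq => y _ /=.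
apply: (@integral_derive1_bounded_support (fun a => G (rV_cons (a, y))) _ B).
- by move=> a; apply: continuous_comp; [exact: rV_cons_continuous1|exact: cdG].
- move=> a; apply: (@is_derive_affine R 'rV[R]_n.+1 (fun a => rV_cons (a, y)) G a
      1 (delta_mx 0 ord0)).
    move=> h; exact: rV_cons_shift0.
  by rewrite -i0.
- by move=> a aB; apply: GB; rewrite (lt_le_trans aB)// norm_rV_cons1.
- by move=> a aB; apply: dGB; rewrite (lt_le_trans aB)// norm_rV_cons1.
Qed.

(** The exterior of a closed ball is open, so [G] is locally zero there. *)
Lemma partial_derive_bounded_support n (i : 'I_n) (G dG : 'rV[R]_n -> R) B :
  (forall x : 'rV[R]_n, is_derive x (delta_mx 0 i) G (dG x)) ->
  (forall x, B < `|x| -> G x = 0) -> forall x, B < `|x| -> dG x = 0.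
Proof.
move=> DG GB x Bx.
have G0 : \near x, (cst 0 : 'rV[R]_n -> R) x = G x.
  near=> z; rewrite GB//; near: z.
  by apply: (cvgr_gt (`|x|)) => //; exact: norm_continuous.
have := near_eq_is_derive G0 (is_derive_cst (0 : R) x (delta_mx 0 i)).
by move=> [_ <-]; have [_ <-] := DG x.
Unshelve. all: by end_near. Qed.

Lemma integral_partial_derive n (i : 'I_n) (G dG : 'rV[R]_n -> R) B :
  continuous dG ->
  (forall x : 'rV[R]_n, is_derive x (delta_mx 0 i) G (dG x)) ->
  (forall x, B < `|x| -> G x = 0) ->
  (\int[lebesgue_rV R n]_x (dG x)%:E = 0)%E.
Proof.
move=> cdG DG GB; apply: (integral_partial_derive_aux n i G dG B) => //.
exact: (partial_derive_bounded_support n i G).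
Qed.

End divergence.

(** * Integrals of log-radial functions *)

Section squared_norm.
Context {R : realType} {n : nat}.
Implicit Types x y : 'rV[R]_n.

(** Radial functions are written through the square because it is polynomial, hence differentiable
    at the origin too. *)
Definition sqnorm x : R := dotrV x x.

Lemma sqnormE x : sqnorm x = \sum_(i < n) x 0 i ^+ 2.
Proof. by apply: eq_bigr => i _; rewrite expr2. Qed.

Lemma sqnorm_ge0 x : 0 <= sqnorm x.
Proof. by rewrite sqnormE sumr_ge0// => i _; exact: sqr_ge0. Qed.

Lemma sqnorm_eq0 x : (sqnorm x == 0) = (x == 0).
Proof.
rewrite sqnormE psumr_eq0; last by move=> i _; exact: sqr_ge0.
apply/allP/eqP => [x0|-> i _]; last by rewrite mxE expr0n eqxx.
apply/rowP => i; rewrite mxE; apply/eqP.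
by have := x0 i (mem_index_enum _); rewrite sqrf_eq0.
Qed.

Lemma sqnorm_gt0 x : (0 < sqnorm x) = (x != 0).
Proof. by rewrite lt0r sqnorm_ge0 andbT sqnorm_eq0. Qed.

Lemma coord_le_sqrt_sqnorm x i : `|x 0 i| <= Num.sqrt (sqnorm x).
Proof.
rewrite -sqrtr_sqr ler_wsqrtr// sqnormE (bigD1 i)//= lerDl.
by rewrite sumr_ge0// => j _; exact: sqr_ge0.
Qed.

Lemma norm_le_sqrt_sqnorm x : `|x| <= Num.sqrt (sqnorm x).
Proof. by apply: norm_le_rV => [|i]; rewrite ?sqrtr_ge0// coord_le_sqrt_sqnorm. Qed.

Lemma is_derive_coord x (i j : 'I_n) :
  is_derive x (delta_mx 0 i) (fun y => y 0 j) ((i == j)%:R : R).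
Proof.
have D : is_derive (x 0 j) (i == j)%:R (fun y : R => y) ((i == j)%:R : R).
  exact: is_derive_id.
apply: (@is_derive_affine _ 'rV[R]_n R (fun y => y 0 j) id x _ _ _ _ D) => h.
by rewrite !mxE eqxx /= eq_sym.
Qed.

Lemma is_derive_sqnorm x (i : 'I_n) :
  is_derive x (delta_mx 0 i) sqnorm (2 * x 0 i).
Proof.
have D j : is_derive x (delta_mx 0 i) (fun y : 'rV[R]_n => y 0 j * y 0 j)
    (2 * x 0 j * (i == j)%:R).
  have := is_derive_funM _ _ _ _ _ _ (is_derive_coord x i j) (is_derive_coord x i j).
  by congr is_derive; ring.
have := is_derive_sum D; rewrite (_ : \sum_(i < n) _ = sqnorm); last first.
  by apply/funext => y; rewrite fct_sumE.
move=> H; apply: (is_derive_eq H).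
rewrite (bigD1 i)//= eqxx mulr1 big1 ?addr0// => j ji.
by rewrite eq_sym (negbTE ji) mulr0.
Qed.

Lemma differentiable_sqnorm x : differentiable sqnorm x.
Proof.
have -> : sqnorm = \sum_(i < n) ((fun y : 'rV[R]_n => y 0 i) * (fun y => y 0 i)).
  by apply/funext => y; rewrite fct_sumE.
apply: differentiable_sum => i.
by apply: differentiableM; exact: differentiable_coord.
Qed.

Lemma sqnorm_continuous : continuous sqnorm.
Proof. by move=> x; apply/differentiable_continuous/differentiable_sqnorm. Qed.

End squared_norm.

Section euler.
Context {R : realType} {n : nat}.
Notation mu := (lebesgue_rV R n).

(* The integrand is the divergence of phi(x) m(|x|^2) x. *)
Lemma integral_euler (phi : 'rV[R]_n -> R) (dphi : 'I_n -> 'rV[R]_n -> R)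
    (m dm : R -> R) B :
  continuous phi -> (forall i, continuous (dphi i)) ->
  (forall i (x : 'rV[R]_n), is_derive x (delta_mx 0 i) phi (dphi i x)) ->
  continuous dm -> (forall q : R, is_derive q 1 m (dm q)) ->
  (forall x, B < `|x| -> phi x * m (sqnorm x) = 0) ->
  (\int[mu]_x (m (sqnorm x) * (\sum_(i < n) x 0%R i * dphi i x) +
    phi x * (n%:R * m (sqnorm x) + 2 * sqnorm x * dm (sqnorm x)))%:E = 0)%E.
Proof.
move=> cphi cdphi Dphi cdm Dm supp.
have cm := derive1_continuous _ _ Dm.
pose G i (x : 'rV[R]_n) := phi x * m (sqnorm x) * x 0 i.
pose dG i (x : 'rV[R]_n) := (dphi i x * m (sqnorm x)
  + phi x * (dm (sqnorm x) * (2 * x 0 i))) * x 0 i + phi x * m (sqnorm x).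
have DG i (x : 'rV[R]_n) : is_derive x (delta_mx 0 i) (G i) (dG i x).
  have D1 := is_derive_fun_comp _ m _ _ _ _ (is_derive_sqnorm x i) (Dm _).
  have D2 := is_derive_funM _ _ _ _ _ _ (Dphi i x) D1.
  have := is_derive_funM _ _ _ _ _ _ D2 (is_derive_coord x i i).
  by rewrite eqxx mulr1.
have csq (h : R -> R) : continuous h -> continuous (fun x : 'rV[R]_n => h (sqnorm x)).
  by move=> ch x; apply: continuous_fun_comp; [exact: sqnorm_continuous|exact: ch].
have cdG i : continuous (dG i).
  have cx (x : 'rV[R]_n) : continuous_at x (fun x : 'rV[R]_n => x 0 i : R).
    exact: coord_continuous.
  move=> x; apply: continuous_funD; last first.
    by apply: continuous_funM; [exact: cphi|exact: csq].
  apply: continuous_funM => //; apply: continuous_funD.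
    by apply: continuous_funM; [exact: cdphi|exact: csq].
  apply: continuous_funM; first exact: cphi.
  apply: continuous_funM; first exact: csq.
  by apply: continuous_funM => //; exact: cst_continuous.
have GB i x : B < `|x| -> G i x = 0 by move=> xB; rewrite /G supp// mul0r.
have intG i : mu.-integrable setT (EFin \o dG i).
  apply: (@continuous_bounded_support_integrable R n (dG i) B); first exact: cdG.
  exact: (partial_derive_bounded_support _ i (G i) _ B (DG i) (GB i)).
have -> : (fun x : 'rV[R]_n => (m (sqnorm x) * (\sum_(i < n) x 0%R i * dphi i x) +
    phi x * (n%:R * m (sqnorm x) + 2 * sqnorm x * dm (sqnorm x)))%:E) =
    (fun x => \sum_(i < n) (EFin \o dG i) x)%E.
  apply/funext => x; rewrite sumEFin; congr EFin.
  rewrite /dG big_split /= sumr_const card_ord.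
  rewrite [X in _ = X + _](eq_bigr (fun i => m (sqnorm x) * (x 0 i * dphi i x) +
    2 * phi x * dm (sqnorm x) * (x 0 i ^+ 2))); last by move=> i _; ring.
  rewrite big_split /= -!mulr_sumr -sqnormE -[(_ * _) *+ n]mulr_natl; ring.
rewrite (integral_sum measurableT intG) big1// => i _.
exact: (integral_partial_derive n i (G i) (dG i) B (cdG i) (DG i) (GB i)).
Qed.

End euler.

Section logarithmic_cutoff.
Context {R : realType}.
Implicit Types h dh : R -> R.

(** Here q stands for |x|^2, so that [ln q / 2] is log |x|. When [h] vanishes near [-oo], the value
    0 continues it across q = 0 without loss of regularity. *)
Definition cutlog h (q : R) : R := if 0 < q then h (ln q / 2) else 0.

Lemma cutlog_eq0 h s q : (forall t, t <= s -> h t = 0) -> q < expR (2 * s) ->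
  cutlog h q = 0.
Proof.
move=> hs qs; rewrite /cutlog; case: ifPn => // q0; apply: hs.
rewrite ler_pdivrMr// -ler_expR lnK ?posrE// mulrC; exact: ltW.
Qed.

Lemma near_cutlog h (q : R) : 0 < q -> \near q, h (ln q / 2) = cutlog h q.
Proof.
move=> q0; near=> z; rewrite /cutlog ifT//; near: z; exact: lt_nbhsr.
Unshelve. all: by end_near. Qed.

Lemma near_cutlog0 h s (q : R) : (forall t, t <= s -> h t = 0) ->
  q < expR (2 * s) -> \near q, 0 = cutlog h q.
Proof.
move=> hs qs; near=> z; rewrite (cutlog_eq0 h s)//; near: z; exact: lt_nbhsl.
Unshelve. all: by end_near. Qed.

Lemma cutlog_continuous h s : continuous h -> (forall t, t <= s -> h t = 0) ->
  continuous (cutlog h).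
Proof.
move=> ch hs q; have [qs|qs] := ltP q (expR (2 * s)).
  apply: (near_cst_continuous 0).
  by apply: filterS (near_cutlog0 h s q hs qs) => z <-.
have q0 : 0 < q by rewrite (lt_le_trans _ qs)// expR_gt0.
have c : continuous_at q (fun q => h (ln q / 2)).
  apply: continuous_fun_comp; last exact: ch.
  apply: continuous_funM; last exact: cst_continuous.
  exact: continuous_ln.
have E : cutlog h q = h (ln q / 2) by rewrite /cutlog q0.
rewrite /continuous_at E; apply: cvg_trans c; apply: near_eq_cvg.
exact: near_cutlog.
Qed.

(** The factor e^(-2t) / 2 is 1/(2q), the derivative of ln q / 2, expressed in t so that the
    derivative is again a [cutlog]. *)
Lemma is_derive_cutlog h dh s : (forall t : R, is_derive t 1 h (dh t)) ->
  (forall t, t <= s -> h t = 0) -> (forall t, t <= s -> dh t = 0) ->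
  forall q : R, is_derive q 1 (cutlog h)
    (cutlog (fun t => dh t * (expR (- (2 * t)) / 2)) q).
Proof.
move=> Dh hs dhs q; have [qs|qs] := ltP q (expR (2 * s)).
  rewrite (cutlog_eq0 _ s)//; last by move=> t ts; rewrite dhs// mul0r.
  exact: near_eq_is_derive (near_cutlog0 h s q hs qs) (is_derive_cst _ _ _).
have q0 : 0 < q by rewrite (lt_le_trans _ qs)// expR_gt0.
apply: near_eq_is_derive (near_cutlog h q q0) _.
have Dln : is_derive q 1 (fun q => ln q / 2) (q^-1 / 2).
  have D := is_derive1_ln q0.
  have := is_derive_funM _ _ _ _ _ _ D (is_derive_cst (2^-1 : R) q 1).
  by rewrite mulr0 addr0.
have := is_derive_fun_comp _ h _ _ _ _ Dln (Dh _).
have E : expR (- (2 * (ln q / 2))) = q^-1.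
  by rewrite mulrC divfK// expRN lnK.
by rewrite /cutlog q0 E.
Qed.

Lemma derive_eq0_left h dh s : (forall t : R, is_derive t 1 h (dh t)) ->
  (forall t, t <= s -> h t = 0) -> forall t, t < s -> dh t = 0.
Proof.
move=> Dh hs t ts.
have h0 : \near t, (cst 0 : R -> R) t = h t.
  by near=> z; rewrite hs// ltW//; near: z; exact: lt_nbhsl.
have [_ <-] := Dh t.
by have [_ ->] := near_eq_is_derive h0 (is_derive_cst (0 : R) t 1).
Unshelve. all: by end_near. Qed.

End logarithmic_cutoff.

Section log_radial_integral.
Context {R : realType} {n : nat}.
Notation mu := (lebesgue_rV R n).
Implicit Types (h dh : R -> R) (x : 'rV[R]_n).

(* log |x| for x != 0; the value at 0 is junk, as ln 0 = 0. *)
Definition lognorm x : R := ln (sqnorm x) / 2.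

(* h(log |x|) |x|^-n for x != 0, and 0 at 0. The image of |x|^-n dx by log |x| is
   a multiple of the Lebesgue measure. *)
Definition wrad h x : R := cutlog (fun t => expR (- (n%:R * t)) * h t) (sqnorm x).

Lemma wradE h x : x != 0 -> wrad h x = expR (- (n%:R * lognorm x)) * h (lognorm x).
Proof. by rewrite -sqnorm_gt0 /wrad /cutlog => ->. Qed.

Lemma wrad0 h : wrad h 0 = 0.
Proof. by rewrite /wrad /cutlog sqnorm_gt0 eqxx. Qed.

Lemma wrad_ge0 h x : (forall t, 0 <= h t) -> 0 <= wrad h x.
Proof.
move=> h0; have [->|x0] := eqVneq x 0; first by rewrite wrad0.
by rewrite wradE// mulr_ge0// expR_ge0.
Qed.

Lemma wrad_continuous h s : continuous h -> (forall t, t <= s -> h t = 0) ->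
  continuous (wrad h).
Proof.
move=> ch hs x; apply: continuous_fun_comp; first exact: sqnorm_continuous.
apply: (cutlog_continuous _ s) => [t|t ts]; last by rewrite hs// mulr0.
apply: continuous_funM; last exact: ch.
apply: continuous_fun_comp; last exact: continuous_expR.
apply: continuousN; apply: continuous_funM; [exact: cst_continuous|exact: cvg_id].
Qed.

Lemma norm_le_expR_lognorm x : x != 0 -> `|x| <= expR (lognorm x).
Proof.
move=> x0; have q0 : 0 < sqnorm x by rewrite sqnorm_gt0.
apply: le_trans (norm_le_sqrt_sqnorm x) _.
rewrite -(@ler_pXn2r _ 2) ?nnegrE ?sqrtr_ge0 ?expR_ge0// sqr_sqrtr ?(ltW q0)//.
by rewrite -expRM_natl /lognorm mulrC divfK// lnK.
Qed.

Lemma wrad_support h T x : (forall t, T <= t -> h t = 0) -> expR T < `|x| ->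
  wrad h x = 0.
Proof.
move=> hT xT; have x0 : x != 0.
  by rewrite -normr_gt0 (lt_trans _ xT)// expR_gt0.
rewrite wradE// hT ?mulr0// -ler_expR.
by rewrite (le_trans (ltW xT))// norm_le_expR_lognorm.
Qed.

Lemma wrad_integrable h s T : continuous h -> (forall t, t <= s -> h t = 0) ->
  (forall t, T <= t -> h t = 0) -> mu.-integrable setT (EFin \o wrad h).
Proof.
move=> ch hs hT; apply: (@continuous_bounded_support_integrable _ _ _ (expR T)).
  exact: wrad_continuous ch hs.
by move=> x; exact: wrad_support.
Qed.

(** This is [integral_euler] with m(q) = e^(-nt) h(t), t = ln q / 2. As 2 q m'(q) is the derivative
    of m in t, the sum n m + 2 q m' collapses to e^(-nt) h'(t). *)
Lemma integral_wrad_by_parts (phi : 'rV[R]_n -> R) (dphi : 'I_n -> 'rV[R]_n -> R)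
    h dh s B :
  continuous phi -> (forall i, continuous (dphi i)) ->
  (forall i x, is_derive x (delta_mx 0 i) phi (dphi i x)) ->
  continuous dh -> (forall t : R, is_derive t 1 h (dh t)) ->
  (forall t, t <= s -> h t = 0) ->
  (forall x, B < `|x| -> phi x * wrad h x = 0) ->
  (\int[mu]_x (wrad h x * (\sum_(i < n) x 0%R i * dphi i x)
    + phi x * wrad dh x)%:E = 0)%E.
Proof.
move=> cphi cdphi Dphi cdh Dh hs supp.
have dhs := derive_eq0_left h dh s Dh hs.
pose w t : R := expR (- (n%:R * t)).
have Dw (t : R) : is_derive t 1 w (- n%:R * w t).
  by rewrite /w; apply: is_derive_eq; rewrite /GRing.scale /=; ring.
pose k t := w t * h t; pose dk t := - n%:R * w t * h t + w t * dh t.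
have Dk (t : R) : is_derive t 1 k (dk t) by apply: is_derive_funM.
(* The threshold recedes to [s - 1] because [dh] has been shown to vanish only strictly to the left
   of [s]. *)
have ks t : t <= s - 1 -> k t = 0.
  by move=> ts; rewrite /k hs ?mulr0// (le_trans ts)// gerBl.
have dks t : t <= s - 1 -> dk t = 0.
  move=> ts; have ts' : t < s by rewrite (le_lt_trans ts)// ltrBlDr ltrDl.
  by rewrite /dk hs ?(ltW ts')// dhs// !mulr0 addr0.
have cw := derive1_continuous _ _ Dw; have ch := derive1_continuous _ _ Dh.
have cdk : continuous dk.
  move=> t; apply: continuous_funD; last first.
    by apply: continuous_funM; [exact: cw|exact: cdh].
  apply: continuous_funM; last exact: ch.
  by apply: continuous_funM; [exact: cst_continuous|exact: cw].
have Dm := is_derive_cutlog k dk (s - 1) Dk ks dks.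
have cdm : continuous (cutlog (fun t => dk t * (expR (- (2 * t)) / 2))).
  apply: (cutlog_continuous _ (s - 1)) => [t|t ts]; last by rewrite dks// mul0r.
  apply: continuous_funM; first exact: cdk.
  apply: continuous_funM; last exact: cst_continuous.
  apply: continuous_fun_comp; last exact: continuous_expR.
  by apply: continuousN; apply: continuous_funM; [exact: cst_continuous|exact: cvg_id].
have := integral_euler phi dphi (cutlog k) _ B cphi cdphi Dphi cdm Dm supp.
rewrite (_ : (fun x => _) = (fun x => (wrad h x * (\sum_(i < n) x 0%R i * dphi i x)
    + phi x * wrad dh x)%:E))//.
apply/funext => x; congr (_ + _)%:E; congr (_ * _).
have [->|x0] := eqVneq x 0.
  by rewrite wrad0 /cutlog sqnorm_gt0 eqxx !mulr0 addr0.
rewrite wradE// /cutlog -/(lognorm x).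
have q0 : 0 < sqnorm x by rewrite sqnorm_gt0.
rewrite q0 /k /dk -/(w _).
have -> : expR (- (2 * lognorm x)) = (sqnorm x)^-1.
  by rewrite expRN /lognorm mulrC divfK// lnK.
by field; rewrite gt_eqF.
Qed.

(** The test function is the constant 1, admissible since the support condition bears on its product
    with [wrad h]. *)
Lemma integral_wrad_derive h dh s T : continuous dh ->
  (forall t : R, is_derive t 1 h (dh t)) ->
  (forall t, t <= s -> h t = 0) -> (forall t, T <= t -> h t = 0) ->
  (\int[mu]_x (wrad dh x)%:E = 0)%E.
Proof.
move=> cdh Dh hs hT.
have D1 (i : 'I_n) x : is_derive x (delta_mx 0 i) (cst 1 : 'rV[R]_n -> R) 0.
  exact: is_derive_cst.
have supp x : expR T < `|x| -> cst 1 x * wrad h x = 0.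
  by move=> xT; rewrite (wrad_support h T)// mulr0.
have c0 (i : 'I_n) : continuous ((fun=> 0) : 'rV[R]_n -> R).
  exact: cst_continuous.
have c1 : continuous (cst 1 : 'rV[R]_n -> R) by exact: cst_continuous.
have <- := integral_wrad_by_parts (cst 1) (fun _ => fun=> 0) h dh s (expR T)
  c1 c0 D1 cdh Dh hs supp.
apply: eq_integral => x _; rewrite big1 => [|i _]; last by rewrite mulr0.
by rewrite mulr0 add0r mul1r.
Qed.

End log_radial_integral.

(** * Compactly supported weights and the normalised bump *)

Section compact_support.
Context {R : realType}.
Implicit Types f h : R -> R.

Definition compactly_supported h := exists s T,
  (forall t, t <= s -> h t = 0) /\ (forall t, T <= t -> h t = 0).

Lemma compactly_supportedD f h : compactly_supported f -> compactly_supported h ->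
  compactly_supported (fun t => f t + h t).
Proof.
move=> [s [T [fs fT]]] [s' [T' [hs hT]]]; exists (Num.min s s'), (Num.max T T').
split=> t; rewrite ?le_min ?ge_max => /andP[t1 t2].
  by rewrite fs// hs// addr0.
by rewrite fT// hT// addr0.
Qed.

Lemma compactly_supportedM f h : compactly_supported h ->
  compactly_supported (fun t => f t * h t).
Proof.
by move=> [s [T [hs hT]]]; exists s, T; split => t ht; [rewrite hs|rewrite hT]; rewrite ?mulr0.
Qed.

Lemma compactly_supported_shift h a : compactly_supported h ->
  compactly_supported (fun t => h (t - a)).
Proof.
move=> [s [T [hs hT]]]; exists (s + a), (T + a).
by split => t ht; [apply: hs; rewrite lerBlDr|apply: hT; rewrite lerBrDr].
Qed.

(** A bump carried by [0, 1] with integral 1, together with its primitive, a C^1 step from 0 to 1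
    that provides all the cutoffs. *)
Definition step_pair (k K : R -> R) := [/\ continuous k, forall t, 0 <= k t,
    forall t, 0 < t < 1 -> 0 < k t,
    forall t : R, is_derive t 1 K (k t) &
    (forall t, t <= 0 -> k t = 0 /\ K t = 0) /\
    (forall t, 1 <= t -> k t = 0 /\ K t = 1)].

Lemma step_pair_exists : exists k K, step_pair k K.
Proof.
pose k0 (t : R) := Num.max 0 (t * (1 - t)).
have ck0 : continuous k0.
  move=> t; apply: (@continuous_max _ _ (cst 0) (fun t : R => t * (1 - t))).
    exact: cst_continuous.
  apply: continuous_funM; first exact: cvg_id.
  by apply: continuous_funB; [exact: cst_continuous|exact: cvg_id].
have k0_ge0 t : 0 <= k0 t by rewrite le_max lexx.
have k0_gt0 t : 0 < t < 1 -> 0 < k0 t.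
  by move=> /andP[t0 t1]; rewrite lt_max mulr_gt0 ?subr_gt0// orbT.
have k00 t : t <= 0 -> k0 t = 0.
  by move=> t0; apply/max_idPl; rewrite mulr_le0_ge0//; lra.
have k01 t : 1 <= t -> k0 t = 0.
  by move=> t1; apply/max_idPl; rewrite mulr_ge0_le0//; lra.
have [K0 K00 DK0] := antiderivative_exists _ ck0.
have K0neg t : t <= 0 -> K0 t = 0.
  move=> t0; have [c /andP[_ c0]] := MVT_global _ _ _ _ DK0 t0.
  by rewrite K00 sub0r k00// mul0r => /eqP; rewrite oppr_eq0 => /eqP.
have K0pos t : 1 <= t -> K0 t = K0 1.
  move=> t1; have [c /andP[c1 _]] := MVT_global _ _ _ _ DK0 t1.
  by rewrite k01// mul0r => /eqP; rewrite subr_eq0 => /eqP.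
(* The middle half of [0, 1] contributes a positive increment, the two outer quarters nonnegative
   ones. *)
have K0_1 : 0 < K0 1.
  have half : (0 : R) <= 1/4 by lra.
  have [c _ E1] := MVT_global _ _ _ _ DK0 half.
  have q : (1/4 : R) < 3/4 by lra.
  have cK0 : {within `[1/4, 3/4 : R], continuous K0}.
    exact/continuous_subspaceT/(derive1_continuous _ _ DK0).
  have DK0' (x : R) : x \in `](1/4 : R), 3/4[ -> is_derive x 1 K0 (k0 x).
    by move=> _; exact: DK0.
  have [d + E2] := MVT q DK0' cK0.
  rewrite in_itv /= => /andP[d1 d2].
  have r : (3/4 : R) <= 1 by lra.
  have [e _ E3] := MVT_global _ _ _ _ DK0 r.
  have d01 : 0 < d < 1 by apply/andP; split; lra.
  have := k0_gt0 d d01; have := k0_ge0 c; have := k0_ge0 e.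
  move: E1 E2 E3; rewrite K00; nra.
exists (fun t => k0 t / K0 1), (fun t => K0 t / K0 1); split.
- by move=> t; apply: continuous_funM; [exact: ck0|exact: cst_continuous].
- by move=> t; rewrite divr_ge0// ltW.
- by move=> t t01; rewrite divr_gt0// k0_gt0.
- move=> t; have := is_derive_funM _ _ _ _ _ _ (DK0 t) (is_derive_cst (K0 1)^-1 t 1).
  by rewrite mulr0 addr0.
- split=> t t0; first by rewrite k00// (K0neg t)// !mul0r.
  by rewrite k01// (K0pos t)// mul0r divff// gt_eqF.
Qed.

Lemma step_pair_le k K : step_pair k K -> forall a b, a <= b -> K a <= K b.
Proof.
move=> [_ k0 _ DK _] a b ab; have [c _ E] := MVT_global _ _ _ _ DK ab.
by rewrite -subr_ge0 E mulr_ge0// subr_ge0.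
Qed.

Lemma step_pair_itv k K : step_pair k K -> forall t, 0 <= K t <= 1.
Proof.
move=> kK t; have := step_pair_le _ _ kK; case: kK => _ _ _ _ [h0 h1] le.
apply/andP; split.
  have [t0|/ltW t0] := leP t 0; first by rewrite (h0 t t0).2.
  by rewrite -(h0 0 (lexx _)).2 le.
have [t1|/ltW t1] := leP 1 t; first by rewrite (h1 t t1).2.
by rewrite -(h1 1 (lexx _)).2 le.
Qed.

End compact_support.

Section radial_integral.
Context {R : realType} (n : nat).
Notation mu := (lebesgue_rV R n).
Implicit Types (f h : R -> R) (x : 'rV[R]_n).

(** In polar coordinates this is the area of the unit sphere times the integral of [h] over the
    line; on a bump of integral 1 it is that area. *)
Definition radint h : R := (\int[mu]_x (wrad h x))%R.

Lemma wradD f h x : wrad (fun t => f t + h t) x = wrad f x + wrad h x.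
Proof.
have [->|x0] := eqVneq x 0; first by rewrite !wrad0 addr0.
by rewrite !wradE// mulrDr.
Qed.

Lemma wradZ c h x : wrad (fun t => c * h t) x = c * wrad h x.
Proof.
have [->|x0] := eqVneq x 0; first by rewrite !wrad0 mulr0.
by rewrite !wradE// mulrCA.
Qed.

Lemma wrad_le f h x : (forall t, f t <= h t) -> wrad f x <= wrad h x.
Proof.
move=> fh; have [->|x0] := eqVneq x 0; first by rewrite !wrad0.
by rewrite !wradE// ler_wpM2l// expR_ge0.
Qed.

Lemma compactly_supported_wrad_integrable h : continuous h ->
  compactly_supported h -> mu.-integrable setT (EFin \o wrad h).
Proof. by move=> ch [s [T [hs hT]]]; exact: (wrad_integrable h s T). Qed.

Lemma radintD f h : continuous f -> continuous h ->
  compactly_supported f -> compactly_supported h ->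
  radint (fun t => f t + h t) = radint f + radint h.
Proof.
move=> cf ch sf sh; rewrite -RintegralD//; last 2 first.
- exact: compactly_supported_wrad_integrable.
- exact: compactly_supported_wrad_integrable.
by apply: eq_Rintegral => x _; exact: wradD.
Qed.

Lemma radintZ c h : continuous h -> compactly_supported h ->
  radint (fun t => c * h t) = c * radint h.
Proof.
move=> ch sh; rewrite -RintegralZl//; last first.
  exact: compactly_supported_wrad_integrable.
by apply: eq_Rintegral => x _; exact: wradZ.
Qed.

Lemma radint_le f h : continuous f -> continuous h ->
  compactly_supported f -> compactly_supported h -> (forall t, f t <= h t) ->
  radint f <= radint h.
Proof.
move=> cf ch sf sh fh; apply: le_Rintegral => //.
- exact: compactly_supported_wrad_integrable.
- exact: compactly_supported_wrad_integrable.
- by move=> x _; exact: wrad_le.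
Qed.

Lemma radint_derive f df : continuous df ->
  (forall t : R, is_derive t 1 f (df t)) -> compactly_supported f ->
  radint df = 0.
Proof.
move=> cdf Df [s [T [fs fT]]]; rewrite /radint /Rintegral.
by rewrite (integral_wrad_derive f df s T).
Qed.

Lemma wrad_measurable h : continuous h -> measurable_fun setT (wrad h : 'rV[R]_n -> R).
Proof.
move=> ch.
have mq : measurable_fun setT (@sqnorm R n).
  by apply: continuous_measurable_rV; exact: sqnorm_continuous.
have mL : measurable_fun setT (@lognorm R n).
  apply: measurable_funM; last exact: measurable_cst.
  exact: measurableT_comp (@measurable_ln R) mq.
rewrite /wrad /cutlog; apply: measurable_fun_ifT; last exact: measurable_cst.
  by apply: measurable_fun_ltr => //; exact: measurable_cst.
have c : continuous (fun t : R => expR (- (n%:R * t)) * h t).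
  move=> t; apply: continuous_funM; last exact: ch.
  apply: continuous_fun_comp; last exact: continuous_expR.
  by apply: continuousN; apply: continuous_funM; [exact: cst_continuous|exact: cvg_id].
exact: measurableT_comp (continuous_measurable_fun c) mL.
Qed.

Section step.
Variables k K : R -> R.
Hypothesis kK : step_pair k K.

Let ck : continuous k. Proof. by case: kK. Qed.
Let k_ge0 t : 0 <= k t. Proof. by case: kK. Qed.
Let DK (t : R) : is_derive t 1 K (k t). Proof. by case: kK. Qed.
Let cK : continuous K. Proof. exact: derive1_continuous DK. Qed.
Let kneg t : t <= 0 -> k t = 0. Proof. by case: kK => _ _ _ _ [H _] /H[]. Qed.
Let Kneg t : t <= 0 -> K t = 0. Proof. by case: kK => _ _ _ _ [H _] /H[]. Qed.
Let kpos t : 1 <= t -> k t = 0. Proof. by case: kK => _ _ _ _ [_ H] /H[]. Qed.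
Let Kpos t : 1 <= t -> K t = 1. Proof. by case: kK => _ _ _ _ [_ H] /H[]. Qed.

Let sk : compactly_supported k.
Proof. by exists 0, 1; split => t; [exact: kneg|exact: kpos]. Qed.

Lemma is_derive_shift1 f df (a t : R) : is_derive (t - a) 1 f df ->
  is_derive t 1 (fun t => f (t - a)) df.
Proof.
move=> D; have Dt : is_derive t 1 (fun t => t - a) 1.
  by apply: is_derive_eq; rewrite subr0.
by have := is_derive_fun_comp _ f _ _ _ _ Dt D; rewrite mulr1.
Qed.

Lemma continuous_shift1 f a : continuous f -> continuous (fun t => f (t - a)).
Proof.
move=> cf t; apply: continuous_fun_comp; last exact: cf.
by apply: continuous_funB; [exact: cvg_id|exact: cst_continuous].
Qed.

(** A translate of [K] is not compactly supported, but the difference of two is, since both steps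
    end at the value 1. *)
Lemma radint_shift a b : radint (fun t => k (t - a)) = radint (fun t => k (t - b)).
Proof.
have cka c := continuous_shift1 k c ck.
have ska c := compactly_supported_shift k c sk.
have DKa c (t : R) : is_derive t 1 (fun t => K (t - c)) (k (t - c)).
  exact: is_derive_shift1.
apply/eqP; rewrite -subr_eq0 -[- radint _]mulN1r -radintZ// -radintD//; last 2 first.
- by move=> t; apply: continuous_funM; [exact: cst_continuous|exact: cka].
- exact: compactly_supportedM.
apply/eqP; apply: (radint_derive (fun t => K (t - a) + - 1 * K (t - b))).
- move=> t; apply: continuous_funD; first exact: cka.
  by apply: continuous_funM; [exact: cst_continuous|exact: cka].
- exists (Num.min a b), (1 + Num.max a b); split => t.
    rewrite le_min => /andP[ta tb].
    by rewrite !Kneg ?subr_le0// mulr0 addr0.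
  rewrite -lerBrDl ge_max => /andP[ta tb].
  by rewrite !Kpos; [rewrite mulr1 subrr| lra|lra].
Qed.

(* Cutting off near 0 and near infinity makes the derivative of f times the
   cutoff have integral 0; the boundary terms are bounded by M times the
   integral of k. *)
Lemma bounded_derive_wrad_integrable f df M : continuous df ->
  (forall t : R, is_derive t 1 f (df t)) -> (forall t, 0 <= df t) ->
  (forall t, `|f t| <= M) ->
  (\int[mu]_x (wrad df x)%:E < +oo)%E.
Proof.
move=> cdf Df df0 fM.
have cf := derive1_continuous _ _ Df.
(* A plateau equal to 1 on [1 - m, m] and to 0 outside [-m, m + 1]. It increases with m, as monotone
   convergence requires. *)
pose c (m : nat) t := K (t - - m%:R) - K (t - m%:R).
pose dc (m : nat) t := k (t - - m%:R) - k (t - m%:R).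
have Dc m (t : R) : is_derive t 1 (c m) (dc m t).
  by apply: is_derive_funB; exact: is_derive_shift1.
have cc m : continuous (c m).
  by move=> t; apply: continuous_funB; exact: continuous_shift1.
have cka a := continuous_shift1 k a ck.
have ska a := compactly_supported_shift k a sk.
have cdc m : continuous (dc m).
  by move=> t; apply: continuous_funB; exact: cka.
have m0 (m : nat) : 0 <= m%:R :> R by [].
have sc m : compactly_supported (c m).
  exists (- m%:R), (m%:R + 1); split => t tm.
    by rewrite /c !Kneg ?subrr//; have := m0 m; lra.
  by rewrite /c !Kpos ?subrr//; have := m0 m; lra.
have c_ge0 m t : 0 <= c m t.
  by rewrite subr_ge0; apply: (step_pair_le _ _ kK); have := m0 m; lra.
have ndc m m' t : (m <= m')%N -> c m t <= c m' t.
  rewrite -(@ler_nat R) => mm; apply: lerB; apply: (step_pair_le _ _ kK); lra.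
pose g m t := df t * c m t.
have cg m : continuous (g m).
  by move=> t; apply: continuous_funM; [exact: cdf|exact: cc].
have sg m : compactly_supported (g m) by exact: compactly_supportedM.
have Mf : (0 : R) <= M by rewrite (le_trans _ (fM 0)).
have gbound m : radint (g m) <= 2 * M * radint k.
  have cfk a : continuous (fun t => f t * k (t - a)).
    by move=> t; apply: continuous_funM; [exact: cf|exact: cka].
  have cfk' a : continuous (fun t => M * k (t - a)).
    by move=> t; apply: continuous_funM; [exact: cst_continuous|exact: cka].
  have sfk f' a : compactly_supported (fun t => f' t * k (t - a)).
    exact: compactly_supportedM.
  have kr a : radint (fun t => k (t - a)) = radint k.
    rewrite (radint_shift a 0); apply: eq_Rintegral => x _.
    by congr wrad; apply/funext => t; rewrite subr0.
  have fkM a : radint (fun t => f t * k (t - a)) <= M * radint k.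
    rewrite -(kr a) -radintZ//; apply: radint_le => // t.
    by rewrite ler_wpM2r// (le_trans (ler_norm _)).
  have fkM' a : - (M * radint k) <= radint (fun t => f t * k (t - a)).
    rewrite -(kr a) -mulNr -radintZ//; apply: radint_le => //.
      by move=> t; apply: continuous_funM; [exact: cst_continuous|exact: cka].
    by move=> t; rewrite ler_wpM2r// lerNl (le_trans (ler_norm _))// normrN.
  have /eqP : radint (fun t => g m t + (f t * k (t - - m%:R) + -1 * (f t * k (t - m%:R)))) = 0.
    apply: (radint_derive (fun t => f t * c m t)).
    - move=> t; apply: continuous_funD; first exact: cg.
      apply: continuous_funD; first exact: cfk.
      by apply: continuous_funM; [exact: cst_continuous|exact: cfk].
    - move=> t; rewrite [X in is_derive _ _ _ X](_ : _ = df t * c m t + f t * dc m t).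
        exact: is_derive_funM.
      by rewrite /g /dc; ring.
    - exact: compactly_supportedM.
  have c1 : continuous (fun t => -1 * (f t * k (t - m%:R))).
    by move=> t; apply: continuous_funM; [exact: cst_continuous|exact: cfk].
  have s1 : compactly_supported (fun t => -1 * (f t * k (t - m%:R))).
    by apply: (compactly_supportedM (cst (-1))); exact: sfk.
  have c2 : continuous (fun t => f t * k (t - - m%:R) + -1 * (f t * k (t - m%:R))).
    by move=> t; apply: continuous_funD; [exact: cfk|exact: c1].
  have s2 := compactly_supportedD _ _ (sfk f (- m%:R)) s1.
  rewrite !radintD//.
  rewrite radintZ// => /eqP.
  have := fkM m%:R; have := fkM' (- m%:R); lra.
have mg m : measurable_fun setT (fun x : 'rV[R]_n => (wrad (g m) x)%:E).
  by apply/measurable_EFinP; exact: wrad_measurable.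
have g0 m (x : 'rV[R]_n) : setT x -> (0 <= (wrad (g m) x)%:E)%E.
  by move=> _; rewrite lee_fin; apply: wrad_ge0 => t; rewrite mulr_ge0.
have ndg (x : 'rV[R]_n) : setT x ->
    {homo (fun m => (wrad (g m) x)%:E) : a b / (a <= b)%N >-> (a <= b)%E}.
  move=> _ a b ab; rewrite lee_fin; apply: wrad_le => t.
  by rewrite ler_wpM2l// ndc.
have := @cvg_monotone_convergence _ _ _ mu _ measurableT _ mg g0 ndg.
rewrite (eq_integral (fun x => (wrad df x)%:E)); last first.
  move=> x _; apply/cvg_lim => //.
  apply: cvg_near_cst; near=> m; congr EFin.
  have [->|x0] := eqVneq x 0; first by rewrite !wrad0.
  rewrite !wradE// /g /c; congr (_ * _).
  have Lm : `|lognorm x| + 1 <= m%:R by near: m; exact: nbhs_infty_ger.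
  have := ler_norm (lognorm x); have := ler_norm (- lognorm x); rewrite normrN => h1 h2.
  by rewrite Kpos ?(Kneg (_ - _)) ?subr0 ?mulr1//; lra.
move=> cvg; apply: (@le_lt_trans _ _ (2 * M * radint k)%:E); last exact: ltry.
rewrite -(cvg_lim _ cvg)//; apply: lime_le; first by apply/cvg_ex; eexists; exact: cvg.
apply: nearW => m; apply: le_trans (_ : _ <= (radint (g m))%:E)%E _; last by rewrite lee_fin.
rewrite /radint /Rintegral fineK//.
by apply: integrable_fin_num => //; exact: compactly_supported_wrad_integrable.
Unshelve. all: by end_near. Qed.

End step.

End radial_integral.

(** Needed because a solution is tied to its profile off the origin only, hence merely near each
    nonzero point. *)
Lemma near_eq_differentiable (R : realType) (V W : normedModType R)
    (f g : V -> W) (x : V) :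
  (\near x, f x = g x) -> differentiable f x -> differentiable g x.
Proof.
move=> fg /diff_locallyP[cdf /eqaddoP df].
have fgx : f x = g x by exact: nbhs_singleton fg.
have E : g \o shift x = cst (g x) + 'd f x +o_ 0 id.
  apply/eqaddoP => e e0; have := df e e0.
  have /nbhs0P : \forall y \near x, f y = g y by [].
  apply: filterS2 => y /= fgy.
  by rewrite !fctE /= (addrC y x) fgy fgx.
by apply/diff_locallyP; rewrite (diff_unique cdf E).
Qed.

Section radial_integral_positive.
Context {R : realType} (n : nat).

Lemma compactly_supported_radint_gt0 (k : R -> R) : (0 < n)%N -> continuous k ->
  compactly_supported k -> (forall t, 0 <= k t) ->
  (forall t, 0 < t < 1 -> 0 < k t) -> 0 < radint n k.
Proof.
move=> n0 ck sk k0 k01.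
have nR : 0 < n%:R :> R by rewrite ltr0n.
(* On the cube [a, b]^n one has 2 <= |x|^2 <= 3, and 1 < 2 and 3 < e^2 put log |x| inside (0, 1),
   where [k] is positive. The minimum over this compact set of positive measure bounds the integral
   from below. *)
pose a : R := Num.sqrt (2 / n%:R); pose b : R := Num.sqrt (3 / n%:R).
have a0 : 0 < a by rewrite sqrtr_gt0 divr_gt0.
have ab : a < b by rewrite ltr_sqrt ?divr_gt0// ltr_pM2r ?invr_gt0// ltr_nat.
have a2 : a ^+ 2 = 2 / n%:R by rewrite sqr_sqrtr// divr_ge0.
have b2 : b ^+ 2 = 3 / n%:R by rewrite sqr_sqrtr// divr_ge0.
pose A : set 'rV[R]_n := [set x | forall i, `[a, b]%classic (x 0 i)].
have mA : measurable A.
  by apply: (measurable_rV_box (fun=> `[a, b]%classic)) => i; exact: measurable_itv.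
have muA : lebesgue_rV R n A = ((b - a) ^+ n)%:E.
  rewrite (@lebesgue_rV_box R n (fun=> `[a, b]%classic)); last first.
    by move=> i; exact: measurable_itv.
  under eq_bigr do rewrite lebesgue_measure_itv /= lte_fin ab -EFinB.
  by rewrite prodEFin prodr_const card_ord.
have cA : compact A.
  by apply: (@rV_compact R n (fun=> `[a, b]%classic)) => i; exact: segment_compact.
have kA x : A x -> 0 < wrad k x.
  move=> Ax.
  have sqx i : 2 / n%:R <= x 0 i ^+ 2 <= 3 / n%:R.
    have := Ax i; rewrite /= in_itv /= => /andP[ax xb].
    by rewrite -a2 -b2; apply/andP; split; rewrite !expr2; nra.
  have q2 : 2 <= sqnorm x.
    rewrite sqnormE (_ : 2 = \sum_(i < n) (2 / n%:R)); last first.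
      by rewrite sumr_const card_ord -[_ *+ n]mulr_natr divfK// gt_eqF.
    by apply: ler_sum => i _; case/andP: (sqx i).
  have q3 : sqnorm x <= 3.
    rewrite sqnormE (_ : 3 = \sum_(i < n) (3 / n%:R)); last first.
      by rewrite sumr_const card_ord -[_ *+ n]mulr_natr divfK// gt_eqF.
    by apply: ler_sum => i _; case/andP: (sqx i).
  have x0 : x != 0 by rewrite -sqnorm_gt0; lra.
  rewrite wradE// mulr_gt0 ?expR_gt0// k01// /lognorm.
  rewrite divr_gt0//= ?ln_gt0//; last by lra.
  rewrite ltr_pdivrMr// mul1r -ltr_expR lnK ?posrE; last by lra.
  apply: le_lt_trans q3 _; rewrite (_ : 3 = 1 + 2); last by lra.
  by apply: expR_gt1Dx; lra.
have [c Ac minc] : exists2 c, c \in A & forall t, t \in A -> wrad k c <= wrad k t.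
  have [s [T [ks kT]]] := sk.
  apply: EVT_min_rV => //.
    exists (const_mx a) => i; rewrite mxE /= in_itv /= lexx; exact: ltW.
  by apply: continuous_subspaceT; exact: (wrad_continuous k s).
have ik := compactly_supported_wrad_integrable n k ck sk.
have wk0 (x : 'rV[R]_n) : 0 <= wrad k x by exact: wrad_ge0.
rewrite -lte_fin /radint /Rintegral fineK; last exact: integrable_fin_num.
apply: (@lt_le_trans _ _ ((wrad k c)%:E * lebesgue_rV R n A)%E).
  by rewrite muA -EFinM lte_fin mulr_gt0 ?exprn_gt0 ?subr_gt0 ?kA//; exact: set_mem.
rewrite -integral_cst//.
apply: (@le_trans _ _ (\int[lebesgue_rV R n]_(x in A) (wrad k x)%:E)%E).
  apply: ge0_le_integral => //.
  - by move=> x _; rewrite lee_fin.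
  - by apply/measurable_EFinP; apply: measurable_funTS; exact: wrad_measurable.
  - by move=> x Ax; rewrite lee_fin minc//; exact: mem_set.
apply: ge0_subset_integral => //.
- by apply/measurable_EFinP; exact: wrad_measurable.
- by move=> x _; rewrite lee_fin.
Qed.

End radial_integral_positive.

(** * The weak formulation *)

Section radial_gradient.
Context {R : realType} {n : nat}.
Implicit Types (x y : 'rV[R]_n) (u : 'rV[R]_n -> R).

Lemma near_neq0_rV x : x != 0 -> \near x, x != 0.
Proof.
rewrite -sqnorm_gt0 => x0; near=> y; rewrite -sqnorm_gt0; near: y.
by apply: (cvgr_gt (sqnorm x)) => //; exact: sqnorm_continuous.
Unshelve. all: by end_near. Qed.

Lemma expR_lognorm x : x != 0 -> expR (2 * lognorm x) = sqnorm x.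
Proof. by rewrite -sqnorm_gt0 => x0; rewrite mulrC divfK// lnK. Qed.

Lemma enormE x : x != 0 -> enorm x = expR (lognorm x).
Proof.
move=> x0; rewrite /enorm -/(sqnorm x) -expR_lognorm// expRM_natl sqrtr_sqr.
by rewrite ger0_norm// expR_ge0.
Qed.

Lemma lognormE x : x != 0 -> lognorm x = ln (enorm x).
Proof. by move=> x0; rewrite enormE// expRK. Qed.

Lemma dotrVZl c x y : dotrV (c *: x) y = c * dotrV x y.
Proof. by rewrite /dotrV mulr_sumr; apply: eq_bigr => i _; rewrite mxE mulrA. Qed.

Lemma dotrVZr c x y : dotrV x (c *: y) = c * dotrV x y.
Proof. by rewrite /dotrV mulr_sumr; apply: eq_bigr => i _; rewrite mxE mulrCA. Qed.

Lemma enormZ c x : enorm (c *: x) = `|c| * enorm x.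
Proof.
by rewrite /enorm dotrVZl dotrVZr mulrA -expr2 sqrtrM ?sqr_ge0// sqrtr_sqr.
Qed.

Lemma is_derive_lognorm x i : x != 0 ->
  is_derive x (delta_mx 0 i) lognorm (x 0 i / sqnorm x).
Proof.
rewrite -sqnorm_gt0 => x0.
have D1 := is_derive_fun_comp _ (@ln R) _ _ _ _ (is_derive_sqnorm x i)
  (is_derive1_ln x0).
have := is_derive_funM _ _ _ _ _ _ D1 (is_derive_cst (2^-1 : R) x (delta_mx 0 i)).
by move=> D; apply: (is_derive_eq D); rewrite /=; field; exact: lt0r_neq0.
Qed.

Lemma differentiable_radial u (v dv : R -> R) x :
  (forall x, x != 0 -> u x = v (lognorm x)) ->
  (forall t : R, is_derive t 1 v (dv t)) -> x != 0 -> differentiable u x.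
Proof.
move=> uv Dv x0; apply: (@near_eq_differentiable _ _ _ (v \o lognorm)).
  by apply: filterS (near_neq0_rV x x0) => y /uv ->.
apply: differentiable_comp; last by apply/derivable1_diffP; case: (Dv (lognorm x)).
have -> : @lognorm R n = (fun q => ln q / 2) \o sqnorm by [].
apply: differentiable_comp; first exact: differentiable_sqnorm.
have q0 : 0 < sqnorm x by rewrite sqnorm_gt0.
apply/derivable1_diffP.
by have [] := is_derive_funM _ _ _ _ _ _ (is_derive1_ln q0)
  (is_derive_cst (2^-1 : R) (sqnorm x) 1).
Qed.

Lemma gradient_radial u (v dv : R -> R) x :
  (forall x, x != 0 -> u x = v (lognorm x)) ->
  (forall t : R, is_derive t 1 v (dv t)) -> x != 0 ->
  gradient u x = (dv (lognorm x) / sqnorm x) *: x.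
Proof.
move=> uv Dv x0; apply/rowP => i; rewrite !mxE.
have D := is_derive_fun_comp _ v _ _ _ _ (is_derive_lognorm x i x0) (Dv _).
have E : \near x, v (lognorm x) = u x.
  by apply: filterS (near_neq0_rV x x0) => y /uv ->.
by have [_ ->] := near_eq_is_derive E D; rewrite mulrCA mulrC.
Qed.

End radial_gradient.

Section dominated.
Context d (T : measurableType d) (R : realType).
Variable mu : {measure set T -> \bar R}.

Lemma cvg_Rintegral_dominated (f_ : nat -> T -> R) (f g : T -> R) :
  (forall m, measurable_fun setT (f_ m)) -> measurable_fun setT f ->
  (forall x, f_ ^~ x @ \oo --> f x) -> mu.-integrable setT (EFin \o g) ->
  (forall m x, `|f_ m x| <= g x) ->
  mu.-integrable setT (EFin \o f) /\
  (\int[mu]_x f_ m x)%R @[m --> \oo] --> (\int[mu]_x f x)%R.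
Proof.
move=> mf_ mf cf ig fg.
have [||||| intf _ cvg] := @dominated_convergence _ _ _ mu setT measurableT
  (fun m => EFin \o f_ m) (EFin \o f) (EFin \o g).
- by move=> m; exact/measurable_EFinP.
- exact/measurable_EFinP.
- by apply: aeW => x _; apply: cvg_EFin; [exact: nearW|exact: cf].
- exact: ig.
- by apply: aeW => x m _; rewrite lee_fin.
split => //; apply: fine_cvg.
by rewrite fineK//; exact: integrable_fin_num.
Qed.

End dominated.

(** * Indifference of measurability and integrals to the value at the origin *)

Section punctured.
Context {R : realType} {n : nat}.
Implicit Types f g : 'rV[R]_n -> R.

Lemma measurable_fun_punctured f g : measurable_fun setT g ->
  (forall x, x != 0 -> f x = g x) -> measurable_fun setT f.
Proof.
move=> mg fg.
have -> : f = (fun x => if 0 < sqnorm x then g x else f 0).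
  apply/funext => x; rewrite sqnorm_gt0.
  by have [->|/fg] := eqVneq x 0.
have mq : measurable_fun setT (@sqnorm R n).
  by apply: continuous_measurable_rV; exact: sqnorm_continuous.
apply: measurable_fun_ifT => //.
by apply: measurable_fun_ltr.
Qed.

Lemma lebesgue_rV_set0 : (0 < n)%N -> lebesgue_rV R n [set 0] = 0%E.
Proof.
move=> n0; have -> : [set 0 : 'rV[R]_n] = [set x | forall i, [set 0] (x 0 i)].
  apply/seteqP; split => x /= => [-> i|x0]; first by rewrite mxE.
  by apply/rowP => i; rewrite x0 mxE.
rewrite (@lebesgue_rV_box R n (fun=> [set 0]))//.
rewrite (bigD1 (Ordinal n0))//=.
by rewrite lebesgue_measure_set1 mul0e.
Qed.

Lemma integral_punctured f g : (0 < n)%N -> measurable_fun setT g ->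
  (forall x, x != 0 -> f x = g x) ->
  (\int[lebesgue_rV R n]_x (f x)%:E = \int[lebesgue_rV R n]_x (g x)%:E)%E.
Proof.
move=> n0 mg fg; have mf := measurable_fun_punctured f g mg fg.
apply: ae_eq_integral => //; [exact/measurable_EFinP|exact/measurable_EFinP|].
exists [set 0]; split.
- rewrite (_ : [set 0] = ~` [set x : 'rV[R]_n | x != 0]).
    apply: measurableC; apply: open_measurable_rV; rewrite openE => x.
    exact: near_neq0_rV.
  by apply/seteqP; split => x /=; [move=> ->; rewrite eqxx|move/negP/negPn/eqP].
- exact: lebesgue_rV_set0.
- move=> x /= h; have [//|x0] := eqVneq x 0.
  by exfalso; apply: h => _; rewrite fg.
Qed.

Lemma integrable_punctured f g : (0 < n)%N ->
  (lebesgue_rV R n).-integrable setT (EFin \o g) ->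
  (forall x, x != 0 -> f x = g x) ->
  (lebesgue_rV R n).-integrable setT (EFin \o f).
Proof.
move=> n0 /integrableP[/measurable_EFinP mg ig] fg.
have mf := measurable_fun_punctured f g mg fg.
apply/integrableP; split; first exact/measurable_EFinP.
apply: le_lt_trans ig; rewrite le_eqVlt; apply/orP; left; apply/eqP.
apply: (integral_punctured (fun x => `|f x|) (fun x => `|g x|)) => //.
  exact: measurableT_comp.
by move=> x /fg ->.
Qed.

End punctured.

(** * An integrable weight comparable to |x|^(1-n) near the origin *)

Section logistic_weight.
Context {R : realType}.

(** The derivative of the bounded function [logistic], so that [wrad dlogistic] is integrable on the
    whole space. It is comparable to e^t on every half-line bounded above, hence [wrad dlogistic] to
    |x|^(1-n) on bounded sets. *)
Definition dlogistic (t : R) := logistic t * (1 - logistic t).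

Lemma dlogistic_ge0 t : 0 <= dlogistic t.
Proof.
have l0 := ltW (logistic_gt0 t); have l1 := ltW (logistic_lt1 t).
by rewrite mulr_ge0 ?subr_ge0.
Qed.

Lemma dlogistic_continuous : continuous dlogistic.
Proof.
have c : continuous (@logistic R) by exact: derive1_continuous is_derive_logistic.
move=> t; apply: continuous_funM; first exact: c.
by apply: continuous_funB; [exact: cst_continuous|exact: c].
Qed.

Lemma expR_le_dlogistic s t : t <= s -> expR t <= (1 + expR s) ^+ 2 * dlogistic t.
Proof.
move=> ts; have et := expR_gt0 t.
have -> : dlogistic t = expR t / (1 + expR t) ^+ 2.
  rewrite /dlogistic logistic_onem /logistic expRN; field.
  by rewrite !gt_eqF//= addr_gt0.
rewrite mulrCA ler_peMr ?(ltW et)// ler_pdivlMr ?exprn_gt0 ?addr_gt0//.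
by rewrite mul1r ler_pXn2r ?nnegrE ?addr_ge0 ?expR_ge0// lerD2l ler_expR.
Qed.

Lemma sqnorm_le_norm n (x : 'rV[R]_n) B : `|x| <= B -> sqnorm x <= n%:R * B ^+ 2.
Proof.
move=> xB; rewrite sqnormE.
rewrite (_ : n%:R * B ^+ 2 = \sum_(i < n) B ^+ 2); last first.
  by rewrite sumr_const card_ord mulr_natl.
apply: ler_sum => i _; rewrite -real_normK ?num_real//.
have B0 : 0 <= B by exact: le_trans xB.
by rewrite ler_pXn2r ?nnegrE//; apply: le_trans xB; exact: coord_le_norm_rV.
Qed.

Lemma lognorm_le n (x : 'rV[R]_n) B : x != 0 -> `|x| <= B ->
  lognorm x <= ln (n%:R * B ^+ 2) / 2.
Proof.
rewrite -sqnorm_gt0 => x0 xB; rewrite ler_pM2r// ler_ln ?posrE//.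
  exact: sqnorm_le_norm.
exact: lt_le_trans (sqnorm_le_norm _ _ _ xB).
Qed.

End logistic_weight.

Section radial_solution.
Context {R : realType} (k : nat).
Notation n := k.+2.
Notation mu := (lebesgue_rV R n).
Variables (v w : R -> R) (w0 M : R) (kk K : R -> R) (u : 'rV[R]_n -> R).
Hypothesis Dw : forall t : R, is_derive t 1 w (- expR (v t + n%:R * t)).
Hypothesis Dv : forall t : R, is_derive t 1 v (sroot k (w t)).
Hypothesis wM : forall t, `|w t| <= M.
Hypothesis wNy : w t @[t --> -oo] --> w0.
Hypothesis kK : step_pair kk K.
Hypothesis uv : forall x, x != 0 -> u x = v (lognorm x).

Let W t := expR (v t + n%:R * t).

Let cw : continuous w. Proof. exact: derive1_continuous Dw. Qed.
Let cv : continuous v. Proof. exact: derive1_continuous Dv. Qed.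
Let cW : continuous W.
Proof.
move=> t; apply: continuous_fun_comp; last exact: continuous_expR.
apply: continuous_funD; first exact: cv.
by apply: continuous_funM; [exact: cst_continuous|exact: cvg_id].
Qed.
Let M0 : 0 <= M. Proof. exact: le_trans (wM 0). Qed.

Lemma expR_radial x : x != 0 -> expR (u x) = wrad W x.
Proof. by move=> x0; rewrite wradE// uv// /W -expRD; congr expR; ring. Qed.

(** [W] is the derivative of the bounded function - w. *)
Lemma wrad_W_lty : (\int[mu]_x (wrad W x)%:E < +oo)%E.
Proof.
apply: (bounded_derive_wrad_integrable n kk K kK (fun t => - w t) W M) => //.
- by move=> t; have := is_derive_funN _ _ _ _ (Dw t); rewrite opprK.
- by move=> t; exact: expR_ge0.
- by move=> t; rewrite normrN.
Qed.

Lemma expR_radial_lty : (\int[mu]_x (expR (u x))%:E < +oo)%E.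
Proof.
rewrite (integral_punctured _ (wrad W))//; first exact: wrad_W_lty.
  exact: wrad_measurable.
exact: expR_radial.
Qed.

Lemma gradient_radial_solution x : x != 0 ->
  gradient u x = (sroot k (w (lognorm x)) / sqnorm x) *: x.
Proof. by move=> x0; rewrite (gradient_radial _ _ _ _ uv Dv). Qed.

Lemma enorm_gradient x : x != 0 ->
  enorm (gradient u x) = `|sroot k (w (lognorm x))| * expR (- lognorm x).
Proof.
move=> x0; rewrite gradient_radial_solution// enormZ enormE// normrM.
rewrite normfV -expR_lognorm// (ger0_norm (expR_ge0 _)) -expRN -mulrA -expRD.
by congr (_ * expR _); ring.
Qed.

Lemma flux_norm x : x != 0 ->
  enorm (gradient u x) ^+ n.-1 = wrad (fun t => `|w t| * expR t) x.
Proof.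
move=> x0; rewrite enorm_gradient// exprMn norm_srootX -expRM_natl wradE//.
rewrite mulrCA -expRD; congr (_ * expR _).
by rewrite -(natr1 k.+1) /=; ring.
Qed.

(** The flux field is w(log |x|) x / |x|^n: [sroot] undoes the power n - 2 of the gradient, and only
    [w] remains. *)
Lemma flux_dot x y : x != 0 ->
  enorm (gradient u x) ^+ (n - 2) * dotrV (gradient u x) y = wrad w x * dotrV x y.
Proof.
move=> x0; rewrite enorm_gradient// subn2 /= exprMn gradient_radial_solution//.
rewrite dotrVZl -expR_lognorm// wradE//.
rewrite -[in RHS](sroot_normX k (w (lognorm x))).
have -> : expR (- (n%:R * lognorm x)) =
    expR (- lognorm x) ^+ k * (expR (2 * lognorm x))^-1.
  rewrite -expRM_natl -expRN -expRD; congr expR.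
  by rewrite -(natr1 k.+1) -(natr1 k); ring.
by ring.
Qed.

Lemma wrad_dlogistic_integrable : mu.-integrable setT (EFin \o @wrad R n (@dlogistic R)).
Proof.
have c := @dlogistic_continuous R.
apply/integrableP; split; first by apply/measurable_EFinP; exact: wrad_measurable.
rewrite (eq_integral (fun x : 'rV[R]_n => (wrad dlogistic x)%:E)); last first.
  by move=> x _ /=; rewrite ger0_norm// wrad_ge0//; exact: dlogistic_ge0.
apply: (bounded_derive_wrad_integrable n kk K kK logistic dlogistic 1) => //.
- exact: is_derive_logistic.
- exact: dlogistic_ge0.
- by move=> t; rewrite ger0_norm ltW ?logistic_gt0 ?logistic_lt1.
Qed.

(** The left side is |x|^(1-n), the size of the flux up to the bound on [w]; on a bounded set it is
    thus dominated by an integrable function. *)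
Lemma wrad_expR_le (x : 'rV[R]_n) s : x != 0 -> lognorm x <= s ->
  expR (- (n%:R * lognorm x)) * expR (lognorm x) <=
  (1 + expR s) ^+ 2 * wrad dlogistic x.
Proof.
move=> x0 xs; rewrite wradE// [leRHS]mulrCA.
apply: ler_wpM2l; first exact: expR_ge0.
exact: expR_le_dlogistic.
Qed.

Lemma flux_locally_integrable (A : set 'rV[R]_n) : compact A ->
  mu.-integrable A (fun x => (enorm (gradient u x) ^+ n.-1)%:E).
Proof.
move=> cA; have [B B0 AB] := compact_bounded_rV A cA.
pose s := ln (n%:R * B ^+ 2) / 2.
have mA := compact_measurable_rV A cA.
pose h (t : R) := `|w t| * expR t.
have ch : continuous h.
  move=> t; apply: continuous_funM; last exact: continuous_expR.
  by apply: (@continuous_comp _ _ _ w Num.norm (t : R)); [exact: cw|exact: norm_continuous].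
apply/integrable_mkcond => //.
have := @integrable_punctured R n ((fun x => enorm (gradient u x) ^+ n.-1) \_ A)
  (wrad h \_ A) isT.
rewrite -[in X in _ -> _ -> X]restrict_EFin; apply; last first.
  by move=> x x0; rewrite !patchE; case: ifPn => // _; exact: flux_norm.
pose C := M * (1 + expR s) ^+ 2.
apply: (le_integrable measurableT _ _ (integrableZl measurableT C wrad_dlogistic_integrable)).
  apply/measurable_EFinP; apply: (measurable_restrictT _ mA).1.
  by apply: measurable_funTS; exact: wrad_measurable.
move=> x _ /=; rewrite lee_fin patchE.
have l0 : 0 <= wrad dlogistic x by apply: wrad_ge0; exact: dlogistic_ge0.
have C0 : 0 <= C by rewrite mulr_ge0// exprn_ge0// addr_ge0// expR_ge0.
rewrite [leRHS]ger0_norm ?mulr_ge0//.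
case: ifPn => [/set_mem /AB xB|_]; last by rewrite normr0 mulr_ge0.
have [->|x0] := eqVneq x 0; first by rewrite !wrad0 normr0 mulr0.
rewrite wradE// ger0_norm ?mulr_ge0 ?expR_ge0// /h mulrCA /C -mulrA.
apply: ler_pM; rewrite ?mulr_ge0 ?expR_ge0//.
by apply: wrad_expR_le => //; exact: lognorm_le.
Qed.


(** A cutoff near the origin: its transition occupies -m <= log |x| <= 1 - m and shrinks to 0 as m
    grows. The double sign keeps the form of a shift by a constant. *)
Let Kcut (m : nat) (t : R) := K (t - - m%:R).
Let kcut (m : nat) (t : R) := kk (t - - m%:R).

Let ck : continuous kk. Proof. by case: kK. Qed.
Let DK (t : R) : is_derive t 1 K (kk t). Proof. by case: kK. Qed.
Let cK : continuous K. Proof. exact: derive1_continuous DK. Qed.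
Let sk : compactly_supported kk.
Proof.
by case: kK => _ _ _ _ [h0 h1]; exists 0, 1; split => t ht; [case: (h0 t ht)|case: (h1 t ht)].
Qed.

Let Kcut_itv m t : 0 <= Kcut m t <= 1. Proof. exact: (step_pair_itv _ _ kK). Qed.
Let cKcut m : continuous (Kcut m). Proof. exact: continuous_shift1. Qed.
Let ckcut m : continuous (kcut m). Proof. exact: continuous_shift1. Qed.

Let Kcut0 m t : t <= - m%:R -> Kcut m t = 0.
Proof.
move=> tm; case: kK => _ _ _ _ [H _]; have tm0 : t - - m%:R <= 0 by rewrite subr_le0.
by case: (H _ tm0).
Qed.

Let kcut0 m t : t <= - m%:R -> kcut m t = 0.
Proof.
move=> tm; case: kK => _ _ _ _ [H _]; have tm0 : t - - m%:R <= 0 by rewrite subr_le0.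
by case: (H _ tm0).
Qed.

Let Kcut1 m t : 1 - m%:R <= t -> Kcut m t = 1.
Proof.
move=> tm; case: kK => _ _ _ _ [_ H].
have tm1 : 1 <= t - - m%:R by rewrite opprK -lerBlDr.
by case: (H _ tm1).
Qed.

Let kcut1 m t : 1 - m%:R <= t -> kcut m t = 0.
Proof.
move=> tm; case: kK => _ _ _ _ [_ H].
have tm1 : 1 <= t - - m%:R by rewrite opprK -lerBlDr.
by case: (H _ tm1).
Qed.

Let cvg_wrad_Kcut (f : R -> R) (x : 'rV[R]_n) :
  wrad (fun t => f t * Kcut m t) x @[m --> \oo] --> wrad f x.
Proof.
apply: cvg_near_cst; near=> m.
have [->|x0] := eqVneq x 0; first by rewrite !wrad0.
rewrite !wradE// Kcut1 ?mulr1//.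
have mL : 1 - lognorm x <= m%:R by near: m; exact: nbhs_infty_ger.
lra.
Unshelve. all: by end_near. Qed.

Let norm_wrad_Kcut (f : R -> R) m (x : 'rV[R]_n) :
  `|wrad (fun t => f t * Kcut m t) x| <= `|wrad f x|.
Proof.
have [->|x0] := eqVneq x 0; first by rewrite !wrad0.
rewrite !wradE// mulrA normrM ler_piMr//.
by have /andP[? ?] := Kcut_itv m (lognorm x); rewrite ger0_norm.
Qed.

Lemma radint_kcut m : radint n (kcut m) = radint n kk.
Proof.
rewrite /kcut (radint_shift n _ _ kK _ 0); apply: eq_Rintegral => x _.
by congr wrad; apply/funext => t; rewrite subr0.
Qed.

Section weak_form.
Variable phi : 'rV[R]_n -> R.
Hypothesis C1phi : C1_compact_support phi.

Let S x := dotrV x (gradient phi x).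

Let cphi : continuous phi.
Proof. by case: C1phi => d _ _ x; exact: differentiable_continuous. Qed.

Let Dphi (i : 'I_n) (x : 'rV[R]_n) :
  is_derive x (delta_mx 0 i) phi (gradient phi x 0 i).
Proof.
case: C1phi => d _ _; rewrite mxE; apply: derivableP.
by apply: diff_derivable.
Qed.

Let cdphi (i : 'I_n) : continuous (fun x => gradient phi x 0 i).
Proof.
case: C1phi => _ c _ x; apply: (@continuous_comp _ _ _ (gradient phi) (fun M : 'rV[R]_n => M 0 i)).
  exact: c.
exact: coord_continuous.
Qed.

Let phi_support : exists B, forall x, B < `|x| -> phi x = 0.
Proof.
case: C1phi => _ _ /compact_bounded_rV[B _ HB]; exists B => x.
rewrite ltNge; apply: contraNeq => phix; apply: HB.
exact: subset_closure.
Qed.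

Let cS : continuous S.
Proof.
move=> x; apply: continuous_sum_ord => i.
apply: continuous_funM; last exact: cdphi.
exact: coord_continuous.
Qed.

Let dphi_support B : (forall x, B < `|x| -> phi x = 0) ->
  forall i x, B < `|x| -> gradient phi x 0 i = 0.
Proof.
move=> HB i x xB.
exact: (partial_derive_bounded_support _ i phi (fun x => gradient phi x 0 i) B (Dphi i) HB x xB).
Qed.

Let S_support B : (forall x, B < `|x| -> phi x = 0) ->
  forall x, B < `|x| -> S x = 0.
Proof.
move=> HB x xB; rewrite /S /dotrV big1// => i _.
by rewrite (dphi_support B HB) ?mulr0.
Qed.

Let S_bound : exists2 D, 0 <= D & forall x, `|S x| <= D * `|x|.
Proof.
have [B HB] := phi_support.
have /choice[C HC] : forall i, exists C, forall x, `|gradient phi x 0 i| <= C.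
  move=> i; have [C _ HC] := continuous_bounded_support_bounded _ B (cdphi i)
    (dphi_support B HB i).
  by exists C.
have C0 i : 0 <= C i by rewrite (le_trans _ (HC i 0)).
exists (\sum_i C i); first exact: sumr_ge0.
move=> x; rewrite /S /dotrV mulr_suml; apply: le_trans (ler_norm_sum _ _ _) _.
apply: ler_sum => i _; rewrite normrM mulrC.
by apply: ler_pM => //; exact: coord_le_norm_rV.
Qed.

(** The scalar product x . grad phi is at most a constant times |x|, which improves |x|^-n to the
    integrable |x|^(1-n). *)
Let S_le : exists2 C, 0 <= C & forall x : 'rV[R]_n, x != 0 ->
  expR (- (n%:R * lognorm x)) * `|S x| <= C * wrad dlogistic x.
Proof.
have [B HB] := phi_support; have [D D0 HD] := S_bound.
pose s := ln (n%:R * B ^+ 2) / 2.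
have C0 : 0 <= D * (1 + expR s) ^+ 2.
  by rewrite mulr_ge0// exprn_ge0// addr_ge0// expR_ge0.
exists (D * (1 + expR s) ^+ 2) => // x x0.
have l0 : 0 <= wrad dlogistic x by apply: wrad_ge0; exact: dlogistic_ge0.
have [xB|Bx] := leP `|x| B; last first.
  by rewrite (S_support B)// normr0 mulr0 mulr_ge0.
rewrite -mulrA; apply: (@le_trans _ _ (D * (expR (- (n%:R * lognorm x)) * expR (lognorm x)))).
  rewrite [leRHS]mulrCA; apply: ler_wpM2l; first exact: expR_ge0.
  apply: le_trans (HD x) _.
  by rewrite ler_wpM2l// norm_le_expR_lognorm.
by rewrite ler_wpM2l// wrad_expR_le//; exact: lognorm_le.
Qed.

Let wrad_cut_continuous (f : R -> R) m : continuous f ->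
  continuous (wrad (fun t => f t * Kcut m t) : 'rV[R]_n -> R).
Proof.
move=> cf; apply: (wrad_continuous _ (- m%:R)).
  by move=> t; apply: continuous_funM; [exact: cf|exact: cKcut].
by move=> t tm; rewrite Kcut0// mulr0.
Qed.

Let wrad_kcut_continuous (f : R -> R) m : continuous f ->
  continuous (wrad (fun t => f t * kcut m t) : 'rV[R]_n -> R).
Proof.
move=> cf; apply: (wrad_continuous _ (- m%:R)).
  by move=> t; apply: continuous_funM; [exact: cf|exact: ckcut].
by move=> t tm; rewrite kcut0// mulr0.
Qed.

(** [A] is the flux against grad phi and [B] the exponential term, both cut off near 0; [C] comes
    from the derivative of the cutoff and produces the point mass. *)
Let A m x := wrad (fun t => w t * Kcut m t) x * S x.
Let B m x := phi x * wrad (fun t => W t * Kcut m t) x.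
Let C m x := phi x * wrad (fun t => w t * kcut m t) x.

Let iA m : mu.-integrable setT (EFin \o A m).
Proof.
have [b Hb] := phi_support.
apply: (@continuous_bounded_support_integrable R n _ b) => [x|x xb].
  by apply: continuous_funM; [exact: wrad_cut_continuous|exact: cS].
by rewrite /A (S_support b)// mulr0.
Qed.

Let iB m : mu.-integrable setT (EFin \o B m).
Proof.
have [b Hb] := phi_support.
apply: (@continuous_bounded_support_integrable R n _ b) => [x|x xb].
  by apply: continuous_funM; [exact: cphi|exact: wrad_cut_continuous].
by rewrite /B Hb// mul0r.
Qed.

Let iC m : mu.-integrable setT (EFin \o C m).
Proof.
have [b Hb] := phi_support.
apply: (@continuous_bounded_support_integrable R n _ b) => [x|x xb].
  by apply: continuous_funM; [exact: cphi|exact: wrad_kcut_continuous].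
by rewrite /C Hb// mul0r.
Qed.

Let by_parts m :
  (\int[mu]_x A m x = \int[mu]_x B m x - \int[mu]_x C m x)%R.
Proof.
have [b Hb] := phi_support.
pose dh t := - W t * Kcut m t + w t * kcut m t.
have Dh (t : R) : is_derive t 1 (fun t => w t * Kcut m t) (dh t).
  have DKm : is_derive t 1 (Kcut m) (kcut m t) by exact: is_derive_shift1.
  exact: (is_derive_funM _ _ _ _ _ _ (Dw t) DKm).
have cdh : continuous dh.
  move=> t; apply: continuous_funD; apply: continuous_funM.
  - by apply: continuousN; exact: cW.
  - exact: cKcut.
  - exact: cw.
  - exact: ckcut.
have h0 t : t <= - m%:R -> w t * Kcut m t = 0 by move=> ?; rewrite Kcut0// mulr0.
have supp x : b < `|x| -> phi x * wrad (fun t => w t * Kcut m t) x = 0.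
  by move=> ?; rewrite Hb// mul0r.
have /(congr1 fine) /= := integral_wrad_by_parts phi _ _ dh (- m%:R) b cphi cdphi Dphi cdh Dh h0 supp.
rewrite -/(Rintegral mu setT _).
rewrite (@eq_Rintegral _ _ _ mu setT (fun x : 'rV[R]_n => (A m x - B m x) + C m x)); last first.
  move=> x _ /=; rewrite -/(S x) /A /B /C -addrA; congr (_ + _).
  have [->|x0] := eqVneq x 0; first by rewrite !wrad0; ring.
  by rewrite !wradE// /dh; ring.
have iAB : mu.-integrable setT (EFin \o (fun x => A m x - B m x)).
  by have := integrableB measurableT (iA m) (iB m); exact: eq_integrable.
rewrite (RintegralD measurableT iAB (iC m)).
rewrite RintegralB//.
lra.
Qed.

Let lim_A : mu.-integrable setT (EFin \o (fun x => wrad w x * S x)) /\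
  (\int[mu]_x A m x)%R @[m --> \oo] --> (\int[mu]_x (wrad w x * S x))%R.
Proof.
have [c c0 Hc] := S_le.
apply: (@cvg_Rintegral_dominated _ _ _ mu A _ (fun x => M * (c * wrad dlogistic x))).
- by move=> m; apply: continuous_measurable_rV => x; apply: continuous_funM;
    [exact: wrad_cut_continuous|exact: cS].
- apply: measurable_funM; first exact: wrad_measurable.
  exact: continuous_measurable_rV.
- by move=> x; apply: cvgM; [exact: cvg_wrad_Kcut|exact: cvg_cst].
- have := integrableZl measurableT (M * c) wrad_dlogistic_integrable.
  by apply: eq_integrable => // x _ /=; rewrite mulrA.
move=> m x; rewrite /A normrM.
apply: (@le_trans _ _ (`|wrad w x| * `|S x|)).
  by rewrite ler_wpM2r// norm_wrad_Kcut.
have [->|x0] := eqVneq x 0; first by rewrite !wrad0 normr0 mul0r !mulr0.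
rewrite wradE// normrM (ger0_norm (expR_ge0 _)) mulrAC mulrC.
by apply: ler_pM; rewrite ?mulr_ge0 ?expR_ge0//; exact: Hc.
Qed.

Let wrad_W_integrable : mu.-integrable setT (EFin \o (@wrad R n W)).
Proof.
apply/integrableP; split; first by apply/measurable_EFinP; exact: wrad_measurable.
rewrite (eq_integral (fun x : 'rV[R]_n => (wrad W x)%:E)); first exact: wrad_W_lty.
by move=> x _ /=; rewrite ger0_norm// wrad_ge0// => t; exact: expR_ge0.
Qed.

Let lim_B : mu.-integrable setT (EFin \o (fun x => phi x * wrad W x)) /\
  (\int[mu]_x B m x)%R @[m --> \oo] --> (\int[mu]_x (phi x * wrad W x))%R.
Proof.
have [b Hb] := phi_support.
have [c c0 Hc] := continuous_bounded_support_bounded phi b cphi Hb.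
apply: (@cvg_Rintegral_dominated _ _ _ mu B _ (fun x => c * wrad W x)).
- by move=> m; apply: continuous_measurable_rV => x; apply: continuous_funM;
    [exact: cphi|exact: wrad_cut_continuous].
- apply: measurable_funM; last exact: wrad_measurable.
  exact: continuous_measurable_rV.
- by move=> x; apply: cvgM; [exact: cvg_cst|exact: cvg_wrad_Kcut].
- exact: (integrableZl measurableT c wrad_W_integrable).
move=> m x; rewrite /B normrM.
apply: ler_pM => //; apply: le_trans (norm_wrad_Kcut W m x) _.
by rewrite ger0_norm// wrad_ge0// => t; exact: expR_ge0.
Qed.

Let phi_w_near0 e : 0 < e -> \forall m \near \oo, forall x : 'rV[R]_n, x != 0 ->
  lognorm x < 1 - m%:R -> `|phi x * w (lognorm x) - phi 0 * w0| <= e.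
Proof.
(* The error splits as (phi 0 - phi x) w + phi 0 (w0 - w), at most d (M + |phi 0|); the added 1
   keeps the denominator positive. *)
move=> e0; pose d := e / (M + `|phi 0| + 1).
have D0 : 0 < M + `|phi 0| + 1 by rewrite ltr_wpDl// addr_ge0.
have d0 : 0 < d by rewrite divr_gt0.
have Hphi : \forall x \near (0 : 'rV[R]_n), `|phi 0 - phi x| <= d.
  exact: (cvgr_dist_le phi (phi 0) (cphi 0)).
have /nbhs_ballP[r /= r0 Hr] := Hphi.
have [T [_ HT]] := cvgr_dist_le w w0 wNy d d0.
near=> m => x x0 xm.
have xT : lognorm x < T.
  apply: lt_trans xm _; rewrite ltrBlDr -ltrBlDl; near: m; exact: nbhs_infty_gtr.
have xr : `|x| < r.
  apply: le_lt_trans (norm_le_expR_lognorm _ x0) _.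
  rewrite -[ltRHS]lnK ?posrE// ltr_expR; apply: lt_trans xm _.
  rewrite ltrBlDr -ltrBlDl; near: m; exact: nbhs_infty_gtr.
have h1 : `|phi 0 - phi x| <= d.
  by apply: Hr; rewrite -ball_normE /= sub0r normrN.
have h2 : `|w0 - w (lognorm x)| <= d by exact: HT.
have -> : phi x * w (lognorm x) - phi 0 * w0 =
  - ((phi 0 - phi x) * w (lognorm x) + phi 0 * (w0 - w (lognorm x))) by ring.
rewrite normrN; apply: le_trans (ler_normD _ _) _; rewrite !normrM.
have -> : e = d * (M + `|phi 0| + 1) by rewrite /d divfK// gt_eqF.
rewrite mulrDr mulrDr -addrA; apply: lerD; first exact: ler_pM.
by rewrite mulr1 ler_wpDr ?(ltW d0)// mulrC ler_wpM2r.
Unshelve. all: by end_near. Qed.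

(** The integrand concentrates at the origin, so the limit is obtained by squeezing: it lies between
    (phi 0 w0 - e') and (phi 0 w0 + e') times [wrad (kcut m)], whose integral does not depend on
    m. *)
Let lim_C : (\int[mu]_x C m x)%R @[m --> \oo] --> phi 0 * w0 * radint n kk.
Proof.
have kk_ge0 t : 0 <= kk t by case: kK.
have om0 : 0 <= radint n kk.
  by apply: Rintegral_ge0 => x _; exact: wrad_ge0.
apply/cvgrPdist_le => e e0; pose e' := e / (radint n kk + 1).
have om1 : 0 < radint n kk + 1 by rewrite ltr_wpDl.
have e'0 : 0 < e' by rewrite divr_gt0.
have e'e : e' * radint n kk <= e.
  by rewrite /e' mulrAC ler_pdivrMr// ler_pM2l// lerDl.
near=> m.
have Hm : forall x : 'rV[R]_n, x != 0 ->
    lognorm x < 1 - m%:R -> `|phi x * w (lognorm x) - phi 0 * w0| <= e'.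
  by near: m; exact: phi_w_near0.
have ik : mu.-integrable setT (EFin \o @wrad R n (kcut m)).
  apply: compactly_supported_wrad_integrable; first exact: ckcut.
  exact: compactly_supported_shift.
have ikc c : mu.-integrable setT (EFin \o (fun x => c * @wrad R n (kcut m) x)).
  exact: (integrableZl measurableT c ik).
have intk c : (\int[mu]_x (c * wrad (kcut m) x))%R = c * radint n kk.
  by rewrite RintegralZl// -(radint_kcut m).
have C_itv x : (phi 0 * w0 - e') * wrad (kcut m) x <= C m x /\
    C m x <= (phi 0 * w0 + e') * wrad (kcut m) x.
  rewrite /C; have [->|x0] := eqVneq x 0; first by rewrite !wrad0 !mulr0.
  rewrite !wradE//; set g := expR _; have g0 : 0 < g by exact: expR_gt0.
  have [Lm|mL] := ltP (lognorm x) (1 - m%:R); last first.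
    by rewrite kcut1// !mulr0.
  have := Hm x x0 Lm; rewrite ler_norml => /andP[h1 h2].
  have -> : phi x * (g * (w (lognorm x) * kcut m (lognorm x))) =
    phi x * w (lognorm x) * (g * kcut m (lognorm x)) by ring.
  have gk : 0 <= g * kcut m (lognorm x) by apply: mulr_ge0; [exact: ltW|exact: kk_ge0].
  move: (phi x * w _) (phi 0 * w0) h1 h2 => p c h1 h2.
  by split; apply: ler_wpM2r => //; lra.
have l1 := le_Rintegral measurableT (ikc _) (iC m) (fun x _ => (C_itv x).1).
have l2 := le_Rintegral measurableT (iC m) (ikc _) (fun x _ => (C_itv x).2).
rewrite intk in l1; rewrite intk in l2.
by rewrite ler_norml; apply/andP; split; nra.
Unshelve. all: by end_near. Qed.

Lemma weak_formulation :
  (\int[mu]_x (enorm (gradient u x) ^+ (n - 2)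
              * dotrV (gradient u x) (gradient phi x))%:E =
   \int[mu]_x (expR (u x) * phi x)%:E - (radint n kk * w0 * phi 0)%:E)%E.
Proof.
have [iA0 cA] := lim_A; have [iB0 cB] := lim_B.
have mA0 : measurable_fun setT (fun x => wrad w x * S x).
  by case/integrableP : iA0 => /measurable_EFinP.
have mB0 : measurable_fun setT (fun x => phi x * wrad W x).
  by case/integrableP : iB0 => /measurable_EFinP.
rewrite (integral_punctured _ (fun x => wrad w x * S x))//; last first.
  by move=> x x0; exact: flux_dot.
rewrite (integral_punctured (fun x => expR (u x) * phi x) (fun x => phi x * wrad W x))//; last first.
  by move=> x x0; rewrite expR_radial// mulrC.
have EA := fineK (integrable_fin_num measurableT iA0).
have EB := fineK (integrable_fin_num measurableT iB0).
rewrite -[LHS]EA -[X in (_ = X - _)%E]EB -EFinB; congr EFin.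
have -> : radint n kk * w0 * phi 0 = phi 0 * w0 * radint n kk by ring.
have E : (fun m => \int[mu]_x A m x)%R = (fun m => \int[mu]_x B m x - \int[mu]_x C m x)%R.
  by apply/funext => m; exact: by_parts.
rewrite E in cA.
exact: (cvg_unique _ cA (cvgB cB lim_C)).
Qed.

End weak_form.

End radial_solution.

(** * Holder regularity of the gradient *)

Section holder.
Context {R : realType} {n : nat}.
Variables (A : set 'rV[R]_n) (eta D : R).
Hypothesis eta0 : 0 < eta.
Hypothesis AD : forall x y, A x -> A y -> enorm (x - y) <= D.
Implicit Types (f g : 'rV[R]_n -> R) (x y : 'rV[R]_n).

(** Boundedness is included so that the class is stable under products. *)
Definition bounded_holder f := exists C, 0 <= C /\
  (forall x, A x -> `|f x| <= C) /\
  (forall x y, A x -> A y -> `|f x - f y| <= C * enorm (x - y) `^ eta).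

Lemma enorm_ge0 x : 0 <= enorm x.
Proof. exact: sqrtr_ge0. Qed.

(** On a set of bounded diameter a larger Holder exponent may be lowered to [eta], at the price of a
    power of the diameter. *)
Lemma powR_le_diam (p d : R) : eta <= p -> 0 <= d -> d <= D ->
  d `^ p <= D `^ (p - eta) * d `^ eta.
Proof.
move=> ep; rewrite le_eqVlt => /predU1P[<- D0|d0 dD].
  by rewrite powR0 ?mulr_ge0 ?powR_ge0// gt_eqF// (lt_le_trans eta0).
rewrite -[in leLHS](subrK eta p) [in leLHS]powRD; last by apply/implyP => _; exact: lt0r_neq0.
rewrite ler_wpM2r ?powR_ge0//; apply: ge0_ler_powR => //.
- by rewrite subr_ge0.
- by rewrite nnegrE ltW.
- by rewrite nnegrE (le_trans (ltW d0)).
Qed.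

Lemma powR_bounded_holder f (p C C' : R) : eta <= p -> 0 <= C -> 0 <= C' ->
  (forall x, A x -> `|f x| <= C') ->
  (forall x y, A x -> A y -> `|f x - f y| <= C * enorm (x - y) `^ p) ->
  bounded_holder f.
Proof.
move=> ep C0 C'0 fC' fC; exists (C' + C * D `^ (p - eta)).
have CD : 0 <= C * D `^ (p - eta) by rewrite mulr_ge0 ?powR_ge0.
split; first by rewrite addr_ge0.
split=> [x Ax|x y Ax Ay]; first by rewrite (le_trans (fC' _ Ax))// lerDl.
apply: le_trans (fC _ _ Ax Ay) _.
apply: (@le_trans _ _ (C * D `^ (p - eta) * enorm (x - y) `^ eta)).
  by rewrite -mulrA ler_wpM2l// powR_le_diam ?enorm_ge0// AD.
by rewrite ler_wpM2r ?powR_ge0// lerDr.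
Qed.

Lemma lipschitz_bounded_holder f (C C' : R) : eta <= 1 -> 0 <= C -> 0 <= C' ->
  (forall x, A x -> `|f x| <= C') ->
  (forall x y, A x -> A y -> `|f x - f y| <= C * enorm (x - y)) ->
  bounded_holder f.
Proof.
move=> e1 C0 C'0 fC' fC; apply: (powR_bounded_holder f 1 C C') => // x y Ax Ay.
by rewrite powRr1 ?enorm_ge0// fC.
Qed.

Lemma bounded_holderM f g : bounded_holder f -> bounded_holder g ->
  bounded_holder (fun x => f x * g x).
Proof.
move=> [C [C0 [fC fH]]] [C' [C'0 [gC gH]]]; exists (C * C' + C * C').
have CC : 0 <= C * C' by rewrite mulr_ge0.
split; first by rewrite addr_ge0.
split=> [x Ax|x y Ax Ay].
  by rewrite normrM (@le_trans _ _ (C * C'))// ?lerDl// ler_pM// ?fC ?gC.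
have -> : f x * g x - f y * g y = (f x - f y) * g x + f y * (g x - g y) by ring.
apply: le_trans (ler_normD _ _) _; rewrite !normrM mulrDl; apply: lerD.
  by rewrite mulrAC; apply: ler_pM => //; [exact: fH|exact: gC].
by rewrite -mulrA; apply: ler_pM => //; [exact: fC|exact: gH].
Qed.

Lemma enorm_le_sum x : enorm x <= \sum_i `|x 0 i|.
Proof.
have S0 : 0 <= \sum_i `|x 0 i| by apply: sumr_ge0.
rewrite -[leRHS]ger0_norm// -sqrtr_sqr; apply: ler_wsqrtr.
rewrite expr2 mulr_suml; apply: ler_sum => i _.
rewrite -[x 0 i * x 0 i]expr2 -real_normK ?num_real// expr2 ler_wpM2l//.
by rewrite (bigD1 i)//= lerDl sumr_ge0.
Qed.

Lemma coord_le_enorm x i : `|x 0 i| <= enorm x.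
Proof. exact: coord_le_sqrt_sqnorm. Qed.

Lemma bounded_holder_rV (F : 'rV[R]_n -> 'rV[R]_n) :
  (forall i, bounded_holder (fun x => F x 0 i)) ->
  exists C, forall x y, A x -> A y -> enorm (F x - F y) <= C * enorm (x - y) `^ eta.
Proof.
move=> /choice[C HC]; exists (\sum_i C i) => x y Ax Ay.
apply: le_trans (enorm_le_sum _) _; rewrite mulr_suml; apply: ler_sum => i _.
by rewrite !mxE; have [_ [_ H]] := HC i; exact: H.
Qed.

End holder.

Section gradient_holder.
Context {R : realType} (k : nat).
Notation n := k.+2.
Variables (v w W : R -> R) (M : R) (u : 'rV[R]_n -> R).
Hypothesis Dw : forall t : R, is_derive t 1 w (W t).
Hypothesis cW : continuous W.
Hypothesis Dv : forall t : R, is_derive t 1 v (sroot k (w t)).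
Hypothesis wM : forall t, `|w t| <= M.
Hypothesis uv : forall x, x != 0 -> u x = v (lognorm x).

(** For r <= q, 1 + z <= e^z at z = ln (q / r) gives ln q - ln r <= (q - r) / r. *)
Lemma ln_lipschitz (c q r : R) : 0 < c -> c <= q -> c <= r ->
  `|ln q - ln r| <= c^-1 * `|q - r|.
Proof.
move=> c0; wlog qr : q r / r <= q => [H cq cr|cq cr].
  have [rq|/ltW qr] := leP r q; first exact: H.
  by rewrite distrC (distrC q); exact: H.
have q0 : 0 < q by rewrite (lt_le_trans c0).
have r0 : 0 < r by rewrite (lt_le_trans c0).
rewrite !ger0_norm ?subr_ge0 ?ler_ln// -ln_div//.
have := expR_ge1Dx (ln (q / r)); rewrite lnK ?posrE ?divr_gt0// => h.
apply: (@le_trans _ _ (q / r - 1)); first by rewrite lerBrDl.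
rewrite -{1}(divff (lt0r_neq0 r0)) -mulrBl mulrC ler_wpM2r ?subr_ge0//.
by rewrite lef_pV2.
Qed.

(** The gradient is the product of [sroot k (w (lognorm x))], 1/|x|^2 and x. The last two are
    Lipschitz away from 0, the first has exponent 1/(n-1). That equals 1 when n = 2, whereas a
    solution asks for an exponent below 1; 1/n is admissible for every n. *)
Lemma C1holder_loc_radial : C1holder_loc_punctured (n%:R^-1) u.
Proof.
split=> [x x0|A cA A0]; first exact: (differentiable_radial u v _ x uv Dv x0).
have [->|/set0P A_neq0] := eqVneq A set0; first by exists 0.
have [B B0 AB] := compact_bounded_rV A cA.
(* A point of the compact set closest to the origin; it is nonzero, which keeps the whole set at a
   positive distance from 0. *)
have [xm /set_mem Axm Hxm] : exists2 c, c \in A & forall t, t \in A -> sqnorm c <= sqnorm t.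
  by apply: EVT_min_rV => //; apply: continuous_subspaceT; exact: sqnorm_continuous.
have neq0 x : A x -> x != 0 by move=> Ax; apply: contra_not_neq A0 => <-.
pose c := sqnorm xm; have c0 : 0 < c by rewrite sqnorm_gt0 neq0.
have cq x : A x -> c <= sqnorm x by move=> Ax; apply: Hxm; exact: mem_set.
have xB x i : A x -> `|x 0 i| <= B.
  by move=> /AB; apply: le_trans; exact: coord_le_norm_rV.
have eta0 : 0 < n%:R^-1 :> R by rewrite invr_gt0.
have eta1 : n%:R^-1 <= 1 :> R by rewrite invf_le1 ?ler1n.
(* It bounds both the Euclidean diameter and the Lipschitz constant of [sqnorm], since |x_i - y_i|
   and |x_i + y_i| are at most 2 B. *)
pose D := \sum_(i < n) (2 * B).
have AD x y : A x -> A y -> enorm (x - y) <= D.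
  move=> Ax Ay; apply: le_trans (enorm_le_sum _) _; apply: ler_sum => i _.
  rewrite !mxE; apply: le_trans (ler_normB _ _) _.
  by rewrite mulrDl !mul1r lerD// xB.
have lipq x y : A x -> A y -> `|sqnorm x - sqnorm y| <= D * enorm (x - y).
  move=> Ax Ay; rewrite !sqnormE -sumrB /D mulr_suml.
  apply: le_trans (ler_norm_sum _ _ _) _; apply: ler_sum => i _.
  rewrite subr_sqr normrM mulrC; apply: ler_pM => //.
    by rewrite (le_trans (ler_normD _ _))// mulrDl !mul1r lerD// xB.
  by have := coord_le_enorm (x - y) i; rewrite !mxE.
have D0 : 0 <= D by rewrite sumr_ge0// => i _; rewrite mulr_ge0// ltW.
have hx i : bounded_holder A (n%:R^-1) (fun x => x 0 i).
  apply: (lipschitz_bounded_holder A _ D eta0 AD _ 1 B) => //; first exact: ltW.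
    by move=> x Ax; exact: xB.
  by move=> x y _ _; have := coord_le_enorm (x - y) i; rewrite !mxE mul1r.
have hq : bounded_holder A (n%:R^-1) (fun x => (sqnorm x)^-1).
  apply: (lipschitz_bounded_holder A _ D eta0 AD _ (c^-1 * c^-1 * D) c^-1) => //.
  - by rewrite !mulr_ge0// invr_ge0 ltW.
  - by rewrite invr_ge0 ltW.
  - move=> x Ax; have qx : 0 < sqnorm x by rewrite (lt_le_trans c0) ?cq.
    by rewrite ger0_norm ?invr_ge0 ?(ltW qx)// lef_pV2 ?posrE ?cq.
  - move=> x y Ax Ay.
    have qx : 0 < sqnorm x by rewrite (lt_le_trans c0) ?cq.
    have qy : 0 < sqnorm y by rewrite (lt_le_trans c0) ?cq.
    have -> : (sqnorm x)^-1 - (sqnorm y)^-1 =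
       (sqnorm x)^-1 * (sqnorm y)^-1 * (sqnorm y - sqnorm x).
      by field; rewrite !gt_eqF.
    rewrite normrM (ger0_norm (_ : 0 <= _ * _)) ?mulr_ge0 ?invr_ge0 ?(ltW qx) ?(ltW qy)//.
    rewrite -[leRHS]mulrA; apply: ler_pM; rewrite ?mulr_ge0 ?invr_ge0 ?(ltW qx) ?(ltW qy)//.
      by apply: ler_pM; rewrite ?invr_ge0 ?(ltW qx) ?(ltW qy)// lef_pV2 ?posrE ?cq.
    by rewrite distrC lipq.
pose s1 := ln c / 2; pose s2 := ln (n%:R * B ^+ 2) / 2.
have Ls x : A x -> s1 <= lognorm x <= s2.
  move=> Ax; apply/andP; split; last by apply: lognorm_le; [exact: neq0|exact: AB].
  by rewrite ler_pM2r// ler_ln ?posrE ?cq// (lt_le_trans c0) ?cq.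
have s12 : s1 <= s2 by have /andP[] := Ls _ Axm; exact: le_trans.
have [CW CW0 HCW] := continuous_segment_bound W s1 s2 s12 cW.
have lipw x y : A x -> A y ->
    `|w (lognorm x) - w (lognorm y)| <= CW * (c^-1 * D) * enorm (x - y).
  move=> Ax Ay; apply: (@le_trans _ _ (CW * `|lognorm x - lognorm y|)).
    wlog yx : x y Ax Ay / lognorm y <= lognorm x => [H|].
      have [/H|/ltW/H] := leP (lognorm y) (lognorm x); first exact.
      by rewrite distrC (distrC (lognorm x)); apply.
    have [d /andP[yd dx] ->] := MVT_global w W _ _ Dw yx.
    rewrite normrM ler_wpM2r// HCW//.
    have /andP[y1 _] := Ls _ Ay; have /andP[_ x2] := Ls _ Ax.
    by rewrite (le_trans y1 yd) (le_trans dx x2).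
  rewrite -mulrA ler_wpM2l ?(ltW CW0)//.
  rewrite /lognorm -mulrBl normrM [`|2^-1|]ger0_norm ?invr_ge0//.
  apply: (@le_trans _ _ `|ln (sqnorm x) - ln (sqnorm y)|).
    by rewrite ler_piMr// invf_le1// ler1n.
  apply: le_trans (ln_lipschitz c _ _ c0 (cq _ Ax) (cq _ Ay)) _.
  by rewrite -mulrA ler_wpM2l ?invr_ge0 ?(ltW c0)// lipq.
pose p : R := k.+1%:R^-1.
have p0 : 0 <= p by rewrite invr_ge0.
have hs : bounded_holder A (n%:R^-1) (fun x => sroot k (w (lognorm x))).
  have C0 : 0 <= CW * (c^-1 * D) by rewrite !mulr_ge0 ?invr_ge0 ?(ltW c0) ?(ltW CW0).
  apply: (powR_bounded_holder A _ D eta0 AD _ p (2 * (CW * (c^-1 * D)) `^ p) (M `^ p)).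
  - by rewrite /p lef_pV2 ?posrE// ler_nat.
  - by rewrite mulr_ge0 ?powR_ge0.
  - exact: powR_ge0.
  - move=> x Ax; rewrite norm_sroot; apply: ge0_ler_powR => //.
    by rewrite nnegrE (le_trans _ (wM 0)).
  - move=> x y Ax Ay; apply: le_trans (sroot_holder _ _ _) _.
    rewrite -mulrA ler_wpM2l// -powRM ?enorm_ge0//; apply: ge0_ler_powR => //.
      by rewrite nnegrE mulr_ge0 ?enorm_ge0.
    exact: lipw.
have [C HC] : exists C, forall x y, A x -> A y ->
    enorm (((sroot k (w (lognorm x)) / sqnorm x) *: x) -
           ((sroot k (w (lognorm y)) / sqnorm y) *: y)) <=
    C * enorm (x - y) `^ (n%:R^-1).
  apply: (bounded_holder_rV A _ (fun x => (sroot k (w (lognorm x)) / sqnorm x) *: x)) => i.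
  have := bounded_holderM A _ _ _ (bounded_holderM A _ _ _ hs hq) (hx i).
  by congr bounded_holder; apply/funext => x; rewrite mxE.
exists C => x y Ax Ay.
rewrite (gradient_radial u v _ x uv Dv) ?neq0// (gradient_radial u v _ y uv Dv) ?neq0//.
exact: HC.
Qed.

End gradient_holder.

(** * The family of solutions *)

Lemma radial_is_solution (R : realType) (k : nat) (v w kk K : R -> R) (w0 M : R)
    (u : 'rV[R]_k.+2 -> R) :
  (forall t : R, is_derive t 1 w (- expR (v t + k.+2%:R * t))) ->
  (forall t : R, is_derive t 1 v (sroot k (w t))) ->
  (forall t, `|w t| <= M) -> w t @[t --> -oo] --> w0 -> step_pair kk K ->
  (forall x, x != 0 -> u x = v (lognorm x)) ->
  is_solution (radint k.+2 kk * w0) u.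
Proof.
move=> Dw Dv wM wNy kK uv; split.
- exists (k.+2%:R^-1); first by rewrite invr_gt0 ltr0n invf_lt1 ?ltr1n ?ltr0n.
  have cW : continuous (fun t : R => - expR (v t + k.+2%:R * t)).
    move=> t; apply: (continuous_fun_comp _ -%R); last exact: opp_continuous.
    apply: continuous_fun_comp; last exact: continuous_expR.
    apply: continuous_funD; first exact: (derive1_continuous _ _ Dv).
    by apply: continuous_funM; [exact: cst_continuous|exact: cvg_id].
  exact: (C1holder_loc_radial k v w _ M u Dw cW Dv wM uv).
- exact: (expR_radial_lty k v w M kk K u Dw Dv wM kK uv).
- exact: (flux_locally_integrable k v w M kk K u Dw Dv wM kK uv).
- by move=> phi C1phi; exact: (weak_formulation k v w w0 M kk K u Dw Dv wM wNy kK uv).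
Qed.

(** [w] is strictly decreasing and vanishes at 0, so v' has the sign of - t. *)
Lemma profile_unique_max (R : realType) (k : nat) (d : R) (v w : R -> R) :
  (forall t : R, is_derive t 1 w (- expR (v t + d * t))) ->
  (forall t : R, is_derive t 1 v (sroot k (w t))) -> w 0 = 0 ->
  forall t, t != 0 -> v t < v 0.
Proof.
move=> Dw Dv w0 t t0.
have wdecr a b : a < b -> w b < w a.
  move=> ab; have [c _ E] := MVT_global_lt w _ _ _ Dw ab.
  by rewrite -subr_lt0 E nmulr_rlt0 ?subr_gt0// oppr_lt0 expR_gt0.
have [tneg|tpos|t00] := ltgtP t 0; last by rewrite t00 eqxx in t0.
  have [c /andP[_ c0] E] := MVT_global_lt v _ _ _ Dv tneg.
  by rewrite -subr_gt0 E mulr_gt0 ?subr_gt0// sroot_gt0// -w0 wdecr.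
have [c /andP[c0 _] E] := MVT_global_lt v _ _ _ Dv tpos.
rewrite -subr_lt0 E nmulr_rlt0 ?subr_gt0// -oppr_gt0 -srootN sroot_gt0//.
by rewrite oppr_gt0 -w0 wdecr.
Qed.

Theorem theorem4p1 (R : realType) (n : nat) (n_ge2 : (2 <= n)%N)
    (gamma : R) (gamma_gt0 : 0 < gamma) :
  exists U : 'rV[R]_n -> R,
    [/\ radial U,
        forall lambda : R, 0 < lambda ->
          is_solution gamma (rescaled U lambda),
        forall lambda mu : R, 0 < lambda -> 0 < mu -> lambda != mu ->
          exists2 x : 'rV[R]_n, x != 0 & rescaled U lambda x != rescaled U mu x &
        forall lambda : R, 0 < lambda ->
          exists2 V : R -> R, has_profile (rescaled U lambda) V &
            unique_max_at V lambda^-1].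
Proof.
case: n n_ge2 => [|[|k]]// _; set n := k.+2.
have [kk [K kK]] := @step_pair_exists R.
have om0 : 0 < radint n kk.
  case: (kK) => ck k0 k01 _ [h0 h1]; apply: compactly_supported_radint_gt0 => //.
  by exists 0, 1; split => t ht; [case: (h0 t ht)|case: (h1 t ht)].
(* The point mass produced by a flux of limit [w0] is [radint n kk * w0]; this choice makes it
   [gamma]. *)
pose w0 := gamma / radint n kk.
have w00 : 0 < w0 by rewrite divr_gt0.
have gammaE : gamma = radint n kk * w0 by rewrite /w0 mulrC divfK// gt_eqF.
have n0 : 0 < n%:R :> R by rewrite ltr0n.
have [v [w [Dw Dv [M wM] wNy w_0]]] := radial_profile k n%:R w0 n0 w00.
have vmax := profile_unique_max _ _ _ _ _ Dw Dv w_0.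
pose U (x : 'rV[R]_n) := v (lognorm x).
(* A dilation translates log |x| by [ln lambda], so the maximum of [v] at 0 is moved to ln r = - ln
   lambda. *)
pose V (lambda r : R) := v (ln r + ln lambda) + n%:R * ln lambda.
have lognormZ (lambda : R) (x : 'rV[R]_n) : 0 < lambda -> x != 0 ->
    lognorm (lambda *: x) = lognorm x + ln lambda.
  move=> l0 x0; have lx0 : lambda *: x != 0 by rewrite scaler_eq0 negb_or gt_eqF.
  rewrite !lognormE// enormZ gtr0_norm// lnM ?posrE// 1?addrC//.
  by rewrite enormE// expR_gt0.
have UV lambda : 0 < lambda -> has_profile (rescaled U lambda) (V lambda).
  by move=> l0 x x0; rewrite /rescaled /U /V lognormZ// lognormE.
have Vmax lambda : 0 < lambda -> unique_max_at (V lambda) lambda^-1.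
  move=> l0; split; first by rewrite invr_gt0.
  move=> r r0 rl; rewrite /V ltrD2r lnV ?posrE// addNr vmax// addr_eq0 -lnV ?posrE//.
  by apply: contra rl => /eqP /ln_inj ->; rewrite ?posrE ?invr_gt0.
exists U; split.
- by exists (fun r => v (ln r)) => x x0; rewrite /U lognormE.
- move=> lambda l0; rewrite gammaE; set l := ln lambda.
  have Dt (t : R) : is_derive t 1 (fun t => t + l) 1.
    by apply: is_derive_eq; rewrite addr0.
  (* The system is preserved: the added n l completes v (t + l) + n t to the exponent at time t + l.
     The limit of the flux at [-oo], hence [gamma], is unchanged. *)
  apply: (@radial_is_solution R k (fun t => v (t + l) + n%:R * l)
    (fun t => w (t + l)) kk K w0 M).
  + move=> t; have := is_derive_fun_comp _ w _ _ _ _ (Dt t) (Dw (t + l)).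
    by rewrite mulr1 mulrDr addrA addrAC.
  + move=> t; have D := is_derive_fun_comp _ v _ _ _ _ (Dt t) (Dv (t + l)).
    have := is_derive_funD _ _ _ _ _ _ D (is_derive_cst (n%:R * l) t 1).
    by rewrite mulr1 addr0.
  + by move=> t; exact: wM.
  + apply/cvgrPdist_lt => e e0.
    have [T [_ HT]] := cvgr_dist_lt w w0 wNy e e0.
    exists (T - l); split; first exact: num_real.
    by move=> t tT; apply: HT; rewrite -ltrBrDr.
  + exact: kK.
  + by move=> x x0; rewrite /rescaled /U lognormZ.
- move=> lambda mu l0 m0 lm.
  pose e : 'rV[R]_n := delta_mx 0 ord0.
  have e0 : e != 0.
    by apply/eqP => /rowP/(_ ord0); rewrite !mxE !eqxx => /eqP; rewrite oner_eq0.
  have e1 : enorm e = 1.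
    rewrite /enorm -/(sqnorm e) sqnormE (bigD1 ord0)//= big1 => [|i i0].
      by rewrite mxE !eqxx expr1n addr0 sqrtr1.
    by rewrite mxE eqxx (negbTE i0) expr0n.
  have xn0 r : 0 < r -> r^-1 *: e != 0.
    by move=> r0; rewrite scaler_eq0 negb_or e0 andbT invr_eq0 gt_eqF.
  have UVe a r : 0 < a -> 0 < r -> rescaled U a (r^-1 *: e) = V a r^-1.
    move=> a0 r0; rewrite (UV _ a0) ?xn0// enormZ e1 mulr1 gtr0_norm//.
    by rewrite invr_gt0.
  (* If the two functions agree at radius 1/lambda, they differ at 1/mu: the strict maxima give
     V_lambda(1/mu) < V_lambda(1/lambda) = V_mu(1/lambda) < V_mu(1/mu). *)
  have [E|] := eqVneq (rescaled U lambda (lambda^-1 *: e))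
    (rescaled U mu (lambda^-1 *: e)); last by exists (lambda^-1 *: e) => //; exact: xn0.
  exists (mu^-1 *: e); first exact: xn0.
  rewrite !UVe// in E *.
  have [_ /(_ mu^-1)] := Vmax _ l0; rewrite invr_gt0 (inj_eq invr_inj) eq_sym => /(_ m0 lm).
  have [_ /(_ lambda^-1)] := Vmax _ m0; rewrite invr_gt0 (inj_eq invr_inj) => /(_ l0 lm).
  by rewrite -E => h1 h2; rewrite lt_eqF// (lt_trans h2 h1).
- by move=> lambda l0; exists (V lambda); [exact: UV|exact: Vmax].
Qed.
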